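(* Let $E=L^1(T)$ be a $T$-universally complete Dedekind complete Riesz space with weak order unit $u$ and strictly positive conditional expectation operator $T$ with $Tu=u$. Let $(q_j)_{j\in\mathbb{N}_0}$ be a $T$-conditionally independent sequence of components of $u$ with $$s:=\sum_{j=0}^\infty q_j\in L^1(T),$$ and let $h_i=Tq_i$. Then, for all $A\subset\mathbb{N}_0$, $$\bigl|\mathbb{P}_T[s\in A]-\mathrm{Po}(A;Ts)\bigr|\le \sup_{i\in\mathbb{N}_0} h_i .$$
   Context: Setting. A conditional expectation operator $T$ on $E$ is a positive order continuous linear projection $T:E\to E$ that maps weak order units to weak order units and has Dedekind complete range $R(T)$; it is strictly positive if $T|x|=0$ implies $x=0$. Let $E^u$ be the universal completion of $E$. The $T$-universal completion of $E$ is $L^1(T)=\mathrm{dom}(T)-\mathrm{dom}(T)$ with $\mathrm{dom}(T)=\{f\in E^u_+ : \exists$ a net $(f_\alpha)\subset E_+$ with $f_\alpha\uparrow f$ in $E^u$ and $(Tf_\alpha)$ bounded in $E^u\}$; $E$ is $T$-universally complete if $E=L^1(T)$. $E^u$ is equipped with the $f$-algebra structure with algebraic unit $u$, and products are taken there; $R(T)$ is then a universally complete $f$-algebra with unit $u$, $L^1(T)$ is an $R(T)$-module and $T(fg)=fT(g)$ for $f\in R(T)$, $g\in L^1(T)$. A component of $u$ is an element $v$ with $0\le v\le u$ and $(u-v)\wedge v=0$; for components $p,q$ of $u$, $p\cdot q=p\wedge q$. All infinite sums are order limits of partial sums. Conditional independence. Two components $p_1,p_2$ of $u$ are $T$-conditionally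 independent if $T(p_1p_2)=Tp_1\cdot Tp_2$. Two Riesz subspaces $E_1,E_2$ of $E$ are $T$-conditionally independent if every pair of components $p_1\in E_1$, $p_2\in E_2$ of $u$ is $T$-conditionally independent. A family $(E_\lambda)_{\lambda\in\Lambda}$ of (order) closed Riesz subspaces containing $R(T)$ is $T$-conditionally independent if for all disjoint $\Lambda_1,\Lambda_2\subset\Lambda$ the closed Riesz subspaces generated by $\bigcup_{\lambda\in\Lambda_1}E_\lambda$ and by $\bigcup_{\lambda\in\Lambda_2}E_\lambda$ are $T$-conditionally independent. A family $(q_i)$ of components of $u$ is $T$-conditionally independent if the family of closed Riesz subspaces $\langle q_i,R(T)\rangle$ generated by $q_i$ and $R(T)$ is. Poisson. For $H\in R(T)_+$, $H^0:=u$, $e^{-H}=\sum_{k\ge0}(-H)^k/k!\in R(T)_+$, $\mathrm{Po}(k;H):=H^ke^{-H}/k!$ for $k\in\mathbb{N}_0$, and $\mathrm{Po}(A;H):=\sum_{k\in A}\mathrm{Po}(k;H)\in R(T)$ for $A\subset\mathbb{N}_0$. Conditional probability. The element $s$ is written as $s=\sum_{j=0}^\infty j r_j$, where $(r_j)_{j\in\mathbb{N}_0}$ are pairwise disjoint components of $u$ with $\sum_{j=0}^\infty r_j=u$. Then $\mathbb{P}_T[s\in A]:=\sum_{j\in A}Tr_j\in R(T)$. *)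

(* Defs.v *)
From HB Require Import structures.
From mathcomp Require Import all_boot all_order all_algebra.
From mathcomp Require Import all_classical reals.

Set Implicit Arguments.
Unset Strict Implicit.
Unset Printing Implicit Defensive.

Import Order.TTheory GRing.Theory Num.Theory.

Local Open Scope classical_set_scope.
Local Open Scope ring_scope.

(* The lattice operations are part of the mixin: the library's [Order.Lattice]
   cannot be joined with [Lmodule], since [realDomainType] already inherits from
   [Order.Lattice] and [Zmodule] without going through a common join. *)
HB.mixin Record isRieszSpace (R : realType) E
    of GRing.Lmodule R E & Num.POrderedZmodule E := {
  rjoin : E -> E -> E;
  rmeet : E -> E -> E;
  rjoinP : forall x y z : E, (rjoin x y <= z) = (x <= z) && (y <= z);
  rmeetP : forall x y z : E, (z <= rmeet x y) = (z <= x) && (z <= y);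
  rsp_leD2r : forall x y z : E, x <= y -> x + z <= y + z;
  rsp_scale_ge0 : forall (a : R) (x : E), 0 <= a -> 0 <= x -> 0 <= a *: x
}.

#[short(type="rieszSpaceType")]
HB.structure Definition RieszSpace (R : realType) :=
  {E of isRieszSpace R E & GRing.Lmodule R E & Num.POrderedZmodule E}.

(* Archimedean f-algebras, in particular universal completions, are
   automatically commutative, so commutativity is part of the structure.
   As with the lattice operations, the product is a field of the mixin because
   [numDomainType] prevents joining an order with the library's ring structures. *)
HB.mixin Record RieszSpace_isFAlgebra (R : realType) A of RieszSpace R A := {
  fmul : A -> A -> A;
  fone : A;
  fmulA : associative fmul;
  fmulC : commutative fmul;
  fmul1 : left_id fone fmul;
  fmulDl : left_distributive fmul +%R;
  fmulZl : forall (a : R) (x y : A), fmul (a *: x) y = a *: fmul x y;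
  fmul_ge0 : forall x y : A, 0 <= x -> 0 <= y -> 0 <= fmul x y;
  fmul_disjoint : forall x y z : A,
    rmeet x y = 0 -> 0 <= z -> rmeet (fmul x z) y = 0
}.

#[short(type="fAlgebraType")]
HB.structure Definition FAlgebra (R : realType) :=
  {A of RieszSpace_isFAlgebra R A & RieszSpace R A}.

Definition fexp (R : realType) (A : fAlgebraType R) (x : A) (k : nat) : A :=
  iter k (fmul x) fone.

Section RieszSpaces.
Variables (R : realType) (E : rieszSpaceType R).
Implicit Types (x y u p : E) (S D F : set E).

Definition rabs x : E := rjoin x (- x).

Definition disjoint_pos x y : Prop := rmeet x y = 0.

Definition weak_order_unit u : Prop :=
  0 <= u /\ forall x, rmeet (rabs x) u = 0 -> x = 0.

Definition is_component u p : Prop :=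
  0 <= p <= u /\ rmeet (u - p) p = 0.

(* Completeness of D in its own (induced) order: suprema are taken in D. *)
Definition dedekind_complete_in D : Prop :=
  forall S, S `<=` D -> S !=set0 -> ubound S `&` D !=set0 ->
    exists m, [/\ D m, ubound S m & forall b, D b -> ubound S b -> m <= b].

Definition dedekind_complete : Prop := dedekind_complete_in setT.

Definition laterally_complete : Prop :=
  forall S, S !=set0 -> (forall x, S x -> 0 <= x) ->
    (forall x y, S x -> S y -> x <> y -> disjoint_pos x y) ->
    supremums S !=set0.

Definition directed (I : Type) (r : I -> I -> Prop) : Prop :=
  [/\ exists i : I, True,
      forall i, r i i,
      forall i k l, r i k -> r k l -> r i l
    & forall i k, exists l, r i l /\ r k l].

(* Order convergence of a net indexed by (I, r). *)
Definition order_cvg (I : Type) (r : I -> I -> Prop) (x : I -> E) (l : E) :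
    Prop :=
  exists y : I -> E,
    [/\ forall a b, r a b -> y b <= y a,
        infimums (range y) 0
      & forall a, rabs (x a - l) <= y a].

Definition partial_sum (A : set nat) (f : nat -> E) (n : nat) : E :=
  \sum_(0 <= k < n | k \in A) f k.

Definition order_sums (A : set nat) (f : nat -> E) (l : E) : Prop :=
  order_cvg (fun m n : nat => (m <= n)%N) (partial_sum A f) l.

(* Sum of f over A as an order limit; by convention 0 when divergent. *)
Definition order_sum (A : set nat) (f : nat -> E) : E :=
  xget 0 [set l | order_sums A f l].

Definition riesz_subspace F : Prop :=
  [/\ F 0,
      forall (a : R) x y, F x -> F y -> F (a *: x + y),
      forall x y, F x -> F y -> F (rjoin x y)
    & forall x y, F x -> F y -> F (rmeet x y)].

Definition order_closed F : Prop :=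
  forall (I : Type) (r : I -> I -> Prop) (x : I -> E) (l : E),
    directed r -> (forall i, F (x i)) -> order_cvg r x l -> F l.

Definition closed_riesz_subspace F : Prop := riesz_subspace F /\ order_closed F.

Definition closed_riesz_gen S : set E := smallest closed_riesz_subspace S.

Definition order_continuous (T : E -> E) : Prop :=
  forall (I : Type) (r : I -> I -> Prop) (x : I -> E) (l : E),
    directed r -> order_cvg r x l -> order_cvg r (T \o x) (T l).

Record conditional_expectation (T : {linear E -> E}) : Prop := {
  ce_ge0 : forall x, 0 <= x -> 0 <= T x;
  ce_order_continuous : order_continuous T;
  ce_proj : forall x, T (T x) = T x;
  ce_weak_unit : forall e, weak_order_unit e -> weak_order_unit (T e);
  ce_range : dedekind_complete_in (range T)
}.

Definition strictly_positive (T : E -> E) : Prop :=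
  forall x, T (rabs x) = 0 -> x = 0.

Definition nat_decomposition u s (r : nat -> E) : Prop :=
  [/\ forall k, is_component u (r k),
      forall k l, k <> l -> disjoint_pos (r k) (r l),
      order_sums setT r u
    & order_sums setT (fun k => r k *+ k) s].

(* P_T[s \in A]; the decomposition of s, unique when it exists, is picked by
   choice. *)
Definition cond_prob (T : E -> E) u s (A : set nat) : E :=
  let r := xget (fun=> 0) [set r : nat -> E | nat_decomposition u s r] in
  order_sum A (fun k => T (r k)).

End RieszSpaces.

Arguments dedekind_complete {R} E.
Arguments laterally_complete {R} E.

Section UniversalCompletion.
Variables (R : realType) (E Eu : rieszSpaceType R) (j : {linear E -> Eu}).

(* Eu, with the embedding j, is a universal completion of E. *)
Record universal_completion : Prop := {
  uc_dedekind : dedekind_complete Eu;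
  uc_lateral : laterally_complete Eu;
  uc_inj : injective j;
  uc_join : {morph j : x y / rjoin x y};
  uc_meet : {morph j : x y / rmeet x y};
  uc_dense : forall f : Eu, 0 < f -> exists x : E, 0 < x /\ j x <= f
}.

Variable T : E -> E.

Definition T_dom : set Eu := [set f | 0 <= f /\
  exists (I : Type) (r : I -> I -> Prop) (x : I -> E),
    [/\ directed r,
        forall a, 0 <= x a,
        forall a b, r a b -> x a <= x b,
        supremums (range (j \o x)) f
      & exists b, forall a, rabs (j (T (x a))) <= b]].

Definition T_L1 : set Eu :=
  [set h | exists f g, [/\ T_dom f, T_dom g & h = f - g]].

Definition T_universally_complete : Prop := range j = T_L1.

End UniversalCompletion.

Section Independence.
Variables (R : realType) (E : rieszSpaceType R) (Eu : fAlgebraType R).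
Variables (j : {linear E -> Eu}) (T : {linear E -> E}) (u : E).

(* Products are taken in Eu; p is the product of p1 and p2 (which for
   components of u equals their meet, hence lies in E). *)
Definition indep_components (p1 p2 : E) : Prop :=
  exists p : E, j p = fmul (j p1) (j p2) /\ j (T p) = fmul (j (T p1)) (j (T p2)).

Definition indep_subspaces (E1 E2 : set E) : Prop :=
  forall p1 p2 : E, E1 p1 -> E2 p2 ->
    is_component u p1 -> is_component u p2 -> indep_components p1 p2.

Definition indep_family (L : Type) (F : L -> set E) : Prop :=
  (forall i, closed_riesz_subspace (F i) /\ range T `<=` F i) /\
  forall L1 L2 : set L, L1 `&` L2 = set0 ->
    indep_subspaces (closed_riesz_gen (\bigcup_(i in L1) F i))
                    (closed_riesz_gen (\bigcup_(i in L2) F i)).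

Definition indep_component_family (L : Type) (q : L -> E) : Prop :=
  indep_family (fun i => closed_riesz_gen ([set q i] `|` range T)).

End Independence.

Section Poisson.
Variables (R : realType) (A : fAlgebraType R).
Implicit Types H : A.

Definition exp_neg H : A :=
  order_sum setT (fun k => ((k`!)%:R : R)^-1 *: fexp (- H) k).

Definition Po1 (k : nat) H : A := ((k`!)%:R : R)^-1 *: fmul (fexp H k) (exp_neg H).

Definition Po (B : set nat) H : A := order_sum B (fun k => Po1 k H).

End Poisson.

(* Main.v *)
(** Let [H = Ts], let [s_n] be the [n]-th partial sum of the [q_i] and [H_n = T s_n].
    By independence, [P_T[s_n \in A]] is a polynomial in [h_0, ..., h_(n-1)],
    the one giving the Poisson-binomial probabilities.  For real parameters the
    Chen-Stein method bounds the distance of this law to the Poisson law of mean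
    [lambda] by [max h_i + 2 (lambda - \sum_i h_i)], for
    [lambda >= \sum_i h_i].  The bound is transferred to [Eu] by evaluating
    at ultrafilters [U] of idempotents of [Eu]: an element [y] has value [t] at
    [U] if [y] is arbitrarily close to [t] on some idempotent of [U].  Values are
    compatible with the algebra and the order, every element bounded on some
    idempotent of [U] has one, and an inequality that fails in [Eu] fails by some
    [e > 0] on a nonzero idempotent, hence also for values at some [U].  Finally
    [[s \in A]] and [[s_n \in A]] differ by at most [s - s_n], so that the
    distance to bound is at most [\sup_i h_i + 3 (H - H_n)] for every [n], and
    [H - H_n] decreases to [0]. *)

Require Import Defs.
From HB Require Import structures.
From mathcomp Require Import all_boot all_order all_algebra.
From mathcomp Require Import all_classical reals.
From mathcomp Require Import topology normedtype sequences exp.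
From mathcomp Require Import ring lra.

Set Implicit Arguments.
Unset Strict Implicit.
Unset Printing Implicit Defensive.

Import Order.TTheory GRing.Theory Num.Theory.
Import numFieldNormedType.Exports.

Local Open Scope classical_set_scope.
Local Open Scope ring_scope.

(** * The Poisson-binomial law and Stein's equation *)

(** Two obstacles shape the argument: an unbounded element of [Eu] may have no value at an
    ultrafilter, and the value of an order limit need not be the limit of the values. Against the
    first, idempotents on which a given element is bounded are dense, so an inequality need only be
    tested at ultrafilters containing one of them. Against the second, the exponential and Poisson
    series have a numerical majorant wherever [H] is bounded, and such uniform bounds survive order
    limits; [s] and [H] are instead approached through [s_n] and [H_n], and the limit in [n] is
    taken after the return to [Eu]. At a single ultrafilter the value of [H - H_n] need not become
    small, which is why the real estimate must allow [lambda] to exceed the sum of the [h_i].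
    Lateral completeness serves to make the exponential series of an unbounded [H] converge, by
    gluing bounds over disjoint events. The constant 3 is 2 from the real estimate with excess mean
    plus 1 from replacing [s] by [s_n]. *)

Section PoissonReal.
Variable R : realType.
Implicit Types (x c m h lam : R) (l : seq R) (f g : nat -> R) (N k : nat).

Definition expsum x N := \sum_(0 <= k < N) exp_coeff x k.

Lemma expsum_cvg x : expsum x @ \oo --> expR x.
Proof. exact: is_cvg_series_exp_coeff. Qed.

Lemma exp_coeff_pos x k : 0 <= x -> 0 <= exp_coeff x k.
Proof. by move=> x0; rewrite /exp_coeff /= divr_ge0// exprn_ge0. Qed.

Lemma expsum_nondecr x M N : 0 <= x -> (M <= N)%N -> expsum x M <= expsum x N.
Proof.
move=> x0 MN; rewrite /expsum [leRHS](big_cat_nat _ (n := M))//= lerDl.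
by apply: sumr_ge0 => k _; apply: exp_coeff_pos.
Qed.

Lemma expsum_le x N : 0 <= x -> expsum x N <= expR x.
Proof.
move=> x0; rewrite -(cvg_lim _ (@expsum_cvg x))//.
apply: (nondecreasing_cvgn_le (u_ := expsum x)).
  by move=> i j; apply: expsum_nondecr.
by apply/cvg_ex; exists (expR x); apply: expsum_cvg.
Qed.

Lemma expsum_eps x e : 0 < e ->
  exists N0, forall N, (N0 <= N)%N -> `|expR x - expsum x N| <= e.
Proof.
move=> e0; have /cvgrPdist_le /(_ _ e0) [N0 _ h] := @expsum_cvg x.
by exists N0 => N; apply: h.
Qed.

Definition pois lam k := exp_coeff lam k * expR (- lam).

Lemma pois_ge0 lam k : 0 <= lam -> 0 <= pois lam k.
Proof. by move=> l0; rewrite mulr_ge0 ?exp_coeff_pos ?expR_ge0. Qed.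

Lemma pois_gt0 lam k : 0 < lam -> 0 < pois lam k.
Proof.
by move=> l0; rewrite mulr_gt0 ?expR_gt0// /exp_coeff /= divr_gt0 ?exprn_gt0// ltr0n fact_gt0.
Qed.

(** The recursion behind Stein's equation: it makes that equation telescope and compares
    neighbouring tails. *)
Lemma poisS lam k : k.+1%:R * pois lam k.+1 = lam * pois lam k.
Proof.
rewrite /pois /exp_coeff /= factS natrM exprS.
have h : k.+1%:R != 0 :> R by rewrite pnatr_eq0.
have h' : (k`!)%:R != 0 :> R by rewrite pnatr_eq0 -lt0n fact_gt0.
by field; rewrite h' nat1r h.
Qed.

Lemma pois_sum lam N : \sum_(0 <= k < N) pois lam k = expsum lam N * expR (- lam).
Proof. by rewrite /pois /expsum mulr_suml. Qed.

Lemma pois_sum_le1 lam N : 0 <= lam -> \sum_(0 <= k < N) pois lam k <= 1.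
Proof.
move=> l0; rewrite pois_sum expRN ler_pdivrMr ?expR_gt0// mul1r.
exact: expsum_le.
Qed.

Lemma pois_sum_eps lam e : 0 < e ->
  exists N0, forall N, (N0 <= N)%N -> 1 - \sum_(0 <= k < N) pois lam k <= e.
Proof.
move=> e0; have [|N0 h] := @expsum_eps lam (e * expR lam).
  by rewrite mulr_gt0 ?expR_gt0.
exists N0 => N /h; rewrite pois_sum expRN => h1.
rewrite -(ler_pM2r (expR_gt0 lam)); apply: le_trans h1.
by rewrite mulrBl mul1r divfK ?gt_eqF ?expR_gt0// ler_norm.
Qed.

(** Uses that the Poisson law has total mass 1 while mentioning only finite sums. *)
Lemma le_pois_limit (a b c : R) lam : 0 <= c ->
  (forall N, a + c * \sum_(0 <= k < N) pois lam k <= b) -> a + c <= b.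
Proof.
move=> c0 h; apply/ler_addgt0Pr => e e0.
have e1 : 0 < e / (c + 1) by rewrite divr_gt0// ltr_wpDl.
have [N0 /(_ N0 (leqnn _)) hN] := pois_sum_eps lam e1.
have := h N0; set S := \sum_(_ <= _ < _) _ in hN *.
have : c * (1 - S) <= e.
  apply: (@le_trans _ _ (c * (e / (c + 1)))); first by rewrite ler_wpM2l.
  rewrite mulrCA; apply: ler_piMr; first exact: ltW.
  by rewrite ler_pdivrMr ?mul1r ?lerDl// ltr_wpDl.
lra.
Qed.

(** Expectation of [f] at the number of successes in independent trials with success probabilities
    [l], computed by conditioning on the first trial. *)
Fixpoint pbin l f : R :=
  if l is h :: t then h * pbin t (fun k => f k.+1) + (1 - h) * pbin t f else f 0%N.

Definition prob_seq l := forall h, h \in l -> 0 <= h <= 1.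

Lemma prob_seq_cons h l : prob_seq (h :: l) -> 0 <= h <= 1 /\ prob_seq l.
Proof.
move=> hl; split; first by apply: hl; rewrite mem_head.
by move=> k kl; apply: hl; rewrite inE kl orbT.
Qed.

Lemma pbinD l f g : pbin l (fun k => f k + g k) = pbin l f + pbin l g.
Proof. by elim: l f g => //= h l IH f g; rewrite (IH f g) (IH (f \o S) (g \o S))/=; ring. Qed.

Lemma pbinZ l c f : pbin l (fun k => c * f k) = c * pbin l f.
Proof. by elim: l f => //= h l IH f; rewrite (IH f) (IH (f \o S))/=; ring. Qed.

Lemma pbinB l f g : pbin l (fun k => f k - g k) = pbin l f - pbin l g.
Proof. by elim: l f g => //= h l IH f g; rewrite (IH f g) (IH (f \o S) (g \o S))/=; ring. Qed.

Lemma pbin_const l c : pbin l (fun=> c) = c.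
Proof. by elim: l => //= h l ->; ring. Qed.

Lemma pbin_eq l f g : (forall k, (k <= size l)%N -> f k = g k) -> pbin l f = pbin l g.
Proof.
elim: l f g => [|h l IH] f g fg /=; first exact: fg.
rewrite (IH (fun k => f k.+1) (fun k => g k.+1)); last by move=> k kl; apply: fg.
by rewrite (IH f g)// => k kl; apply: fg => /=; apply: leqW.
Qed.

Lemma pbin_le l f g : prob_seq l -> (forall k, f k <= g k) -> pbin l f <= pbin l g.
Proof.
elim: l f g => //= h l IH f g /prob_seq_cons[/andP[h0 h1] pl] fg.
by rewrite lerD// ler_wpM2l ?subr_ge0// IH.
Qed.

Lemma pbin_norm l f c : prob_seq l -> (forall k, `|f k| <= c) -> `|pbin l f| <= c.
Proof.
move=> pl fc; rewrite ler_norml; apply/andP; split.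
  rewrite -(pbin_const l (- c)); apply: pbin_le => // k.
  by have := fc k; rewrite ler_norml => /andP[].
rewrite -[leRHS](pbin_const l); apply: pbin_le => // k.
by have := fc k; rewrite ler_norml => /andP[].
Qed.

(** Induction on the trials. Increments of [f] are controlled only from index 1 on, because [f 0] is
    multiplied by 0 and Stein's equation leaves it free. *)
Lemma stein_pbin l f c : prob_seq l -> (forall k, `|f k.+2 - f k.+1| <= c) ->
  `|(\sum_(h <- l) h) * pbin l (fun k => f k.+1) - pbin l (fun k => k%:R * f k)|
    <= c * \sum_(h <- l) h * h.
Proof.
elim: l f => [|h l IH] f pl fc /=; first by rewrite !big_nil !mul0r subrr normr0 mulr0.
have [/andP[h0 h1] {}pl] := prob_seq_cons pl.
rewrite !big_cons; set L := \sum_(_ <- l) _ in IH *; set Q := \sum_(_ <- l) _ in IH *.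
have e1 : pbin l (fun k => k.+1%:R * f k.+1) =
    pbin l (fun k => k%:R * f k.+1) + pbin l (fun k => f k.+1).
  by rewrite -pbinD; apply: pbin_eq => k _; rewrite -natr1 mulrDl mul1r.
have i1 := IH (fun k => f k.+1) pl (fun k => fc k.+1).
have i2 := IH f pl fc.
have i3 : `|pbin l (fun k => f k.+2) - pbin l (fun k => f k.+1)| <= c.
  by rewrite -pbinB; apply: pbin_norm.
rewrite e1.
set a := pbin l _ in i1 i3 *; set b := pbin l _ in i1 *.
set a' := pbin l _ in i2 i3 *; set b' := pbin l _ in i2 *.
(* The first two summands are the induction hypotheses for a success and a failure of the new trial;
   its own contribution is the last one, of order [h * h]. *)
have -> : (h + L) * (h * a + (1 - h) * a') - (h * (b + a') + (1 - h) * b') =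
  h * (L * a - b) + (1 - h) * (L * a' - b') + h * h * (a - a') by ring.
apply: (le_trans (ler_normD _ _)); rewrite [leRHS]mulrDr [leRHS]addrC; apply: lerD; last first.
  by rewrite normrM ger0_norm ?mulr_ge0// mulrC ler_wpM2r ?mulr_ge0.
apply: (le_trans (ler_normD _ _)).
have h1' : 0 <= 1 - h by rewrite subr_ge0.
rewrite !normrM (ger0_norm h0) (ger0_norm h1').
have -> : c * Q = h * (c * Q) + (1 - h) * (c * Q) by ring.
by apply: lerD; apply: ler_wpM2l.
Qed.

(** Termwise, since [lam * pois lam j = j.+1%:R * pois lam j.+1] and [j <= k]; the shift leaves
    [pois lam 0] over. *)
Lemma pois_cumul_le lam k : 0 <= lam ->
  lam * \sum_(0 <= j < k.+1) pois lam j <= k.+1%:R * \sum_(0 <= j < k.+2) pois lam j.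
Proof.
move=> l0; rewrite [leRHS](_ : _ = k.+1%:R * (pois lam 0 + \sum_(0 <= j < k.+1) pois lam j.+1)); last first.
  by rewrite (big_nat_recl k.+1).
rewrite mulrDr; apply: ler_wpDl; first by rewrite mulr_ge0 ?pois_ge0.
rewrite !mulr_sumr.
apply: ler_sum_nat => j /andP[_ jk]; rewrite -poisS ler_wpM2r ?pois_ge0//.
by rewrite ler_nat.
Qed.

(** The same termwise comparison above [k], where it goes the other way; the infinite tails are cut
    at [N] and the cut is then removed by [le_pois_limit]. *)
Lemma pois_tail_le lam k : 0 <= lam ->
  k.+1%:R * (1 - \sum_(0 <= j < k.+2) pois lam j) <=
    lam * (1 - \sum_(0 <= j < k.+1) pois lam j).
Proof.
move=> l0; set U1 := \sum_(0 <= j < k.+2) _; set U := \sum_(0 <= j < k.+1) _.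
pose S M := \sum_(0 <= j < M) pois lam j.
have SS M : S M.+1 = S M + pois lam M by rewrite /S big_nat_recr.
have key N : k.+1%:R * (S (N + k.+1).+1 - U1) <= lam * (S (N + k.+1)%N - U).
  elim: N => [|N IH]; first by rewrite !subrr !mulr0.
  rewrite addSn; have := leq_addl N k.+1; move: IH; move: (N + k.+1)%N => M IH kM.
  rewrite (SS M.+1) [in leRHS]SS.
  have : k.+1%:R * pois lam M.+1 <= lam * pois lam M.
    by rewrite -poisS ler_wpM2r ?pois_ge0// ler_nat ltnS ltnW.
  move: IH; move: (S M) (S M.+1) (pois _ _) (pois _ _) (k.+1%:R : R) => s1 s2 p1 p2 n; lra.
rewrite mulrBr mulr1 addrC; apply: (@le_pois_limit _ _ _ lam) => // N.
have := key N; have := pois_sum_le1 (N + k.+1) l0; rewrite -!/(S _).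
have : S N <= S (N + k.+1).+1.
  rewrite /S [leRHS](big_cat_nat _ (n := N)) -?addnS ?leq_addr//= lerDl.
  by apply: sumr_ge0 => j _; apply: pois_ge0.
set S1 := S N; set S2 := S (N + k.+1).+1; set S3 := S (N + k.+1)%N => h1 h2 h3.
have : k.+1%:R * S1 <= k.+1%:R * S2 by rewrite ler_wpM2l.
have : lam * S3 <= lam * 1 by rewrite ler_wpM2l.
by move: h3; rewrite !mulrBr; lra.
Qed.

(* For [n = k + 1] and [p = pois lam n], [U] and [V] stand for the Poisson masses
   of [0, k] and of [n + 1, oo), [PA] and [W] for those of their parts in the event,
   and [a] tells whether [n] is in the event. *)
Lemma stein_increment_bound (n lam U p V a PA W : R) :
  0 < n -> 0 <= lam -> 0 <= p -> 0 <= V -> 0 <= PA <= U -> 0 <= W <= V -> 0 <= a <= 1 ->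
  V = 1 - (U + p) -> lam * U <= n * (U + p) -> n * V <= lam * (V + p) ->
  `|n * (PA + a * p - (PA + a * p + W) * (U + p)) - lam * (PA - (PA + a * p + W) * U)|
    <= n * p.
Proof.
move=> n0 l0 p0 V0 /andP[PA0 PAU] /andP[W0 WV] /andP[a0 a1] Ve F1 F2.
(* One nonnegative term minus two others. The positive one is at most [p * n]; the negative ones are
   largest together at [PA = U] and [W = V], where they add up to [p * (n * V + lam * U)], again at
   most [p * n]. *)
have -> : n * (PA + a * p - (PA + a * p + W) * (U + p)) - lam * (PA - (PA + a * p + W) * U)
  = - (PA * (lam * (V + p) - n * V)) + a * p * (n * V + lam * U)
    - W * (n * (U + p) - lam * U) by rewrite Ve; ring.
have G1 : 0 <= lam * (V + p) - n * V by rewrite subr_ge0.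
have G2 : 0 <= n * (U + p) - lam * U by rewrite subr_ge0.
have G3 : 0 <= n * V + lam * U <= n.
  have U0 : 0 <= U by apply: le_trans PAU.
  rewrite addr_ge0 ?mulr_ge0//; first by move: F1; rewrite Ve; lra.
  exact: ltW.
case/andP: G3 => G3 G4.
have H1 : 0 <= PA * (lam * (V + p) - n * V) <= U * (lam * (V + p) - n * V).
  by rewrite mulr_ge0//= ler_wpM2r.
have H2 : 0 <= W * (n * (U + p) - lam * U) <= V * (n * (U + p) - lam * U).
  by rewrite mulr_ge0//= ler_wpM2r.
have H3 : 0 <= a * p * (n * V + lam * U) <= p * n.
  rewrite !mulr_ge0//=; apply: ler_pM => //; first exact: mulr_ge0.
  by rewrite ler_piMl.
have H4 : p * (n * V + lam * U) <= p * n by rewrite ler_wpM2l.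
case/andP: H1 => ? ?; case/andP: H2 => ? ?; case/andP: H3 => ? ?.
rewrite ler_norml; apply/andP; split; last by lra.
have : U * (lam * (V + p) - n * V) + V * (n * (U + p) - lam * U) = p * (n * V + lam * U) by ring.
lra.
Qed.

(** The event is cut at [N] so that its Poisson mass is a finite sum. *)
Lemma stein_solution lam (a : pred nat) N : 0 < lam ->
  exists g, (forall k, lam * g k.+1 - k%:R * g k =
      (a k && (k < N)%N)%:R - \sum_(0 <= j < N | a j) pois lam j) /\
    forall k, `|g k.+2 - g k.+1| <= lam^-1.
Proof.
move=> lgt; have l0 := ltW lgt.
pose b k : R := (a k && (k < N)%N)%:R.
set tot := \sum_(0 <= j < N | a j) _.
have totE M : (N <= M)%N -> tot = \sum_(0 <= j < M) b j * pois lam j.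
  move=> NM; rewrite (big_cat_nat _ (n := N))//= [X in _ + X]big_nat [X in _ + X]big1 ?addr0.
    rewrite /tot big_mkcond; apply: eq_big_nat => j /andP[_ jN].
    by rewrite /b jN andbT; case: (a j); rewrite ?mul1r ?mul0r.
  by move=> j /andP[Nj _]; rewrite /b ltnNge Nj andbF mul0r.
pose U k := \sum_(0 <= j < k.+1) pois lam j.
pose B k := \sum_(0 <= j < k.+1) b j * pois lam j.
have b01 k : 0 <= b k <= 1 by rewrite /b ler0n lern1 leq_b1.
have bp k : 0 <= b k * pois lam k <= pois lam k.
  have /andP[b0 b1] := b01 k; rewrite mulr_ge0 ?pois_ge0//=.
  by rewrite ler_piMl ?pois_ge0.
have BU k : 0 <= B k <= U k.
  apply/andP; split; first by apply: sumr_ge0 => j _; case/andP: (bp j).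
  by apply: ler_sum => j _; case/andP: (bp j).
have totB k : 0 <= tot - B k <= 1 - U k.
  have cat f : \sum_(0 <= j < k.+1 + N) f j =
      \sum_(0 <= j < k.+1) f j + \sum_(k.+1 <= j < k.+1 + N) f j :> R.
    by rewrite (big_cat_nat _ (n := k.+1)) ?leq_addr.
  have := pois_sum_le1 (k.+1 + N) l0; rewrite cat -/(U k) => h.
  rewrite (totE (k.+1 + N)%N) ?leq_addl// cat -/(B k) addrAC subrr add0r.
  apply/andP; split; first by apply: sumr_ge0 => j _; case/andP: (bp j).
  apply: (@le_trans _ _ (\sum_(k.+1 <= j < k.+1 + N) pois lam j)).
    by apply: ler_sum => j _; case/andP: (bp j).
  by rewrite lerBrDl.
(* Multiplied by [pois lam k], the equation telescopes, and summing it up to [k'] forces this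
   formula. The value at 0 is arbitrary. *)
pose g k := if k is k'.+1 then (B k' - tot * U k') / (lam * pois lam k') else 0.
exists g; split.
  case=> [|k] /=.
    rewrite mul0r subr0 /B /U !big_nat1 -/(b 0%N).
    have := pois_gt0 0 lgt; move: (pois lam 0) (b 0%N) => p bb p0.
    by field; rewrite !gt_eqF.
  rewrite -/(b k.+1) -(poisS lam k) /B /U !(big_nat_recr k.+1)//= -/(B k) -/(U k).
  have := pois_gt0 k.+1 lgt; have := pois_gt0 k lgt.
  move: (poisS lam k).
  move: (pois lam k.+1) (pois lam k) (b k.+1) (B k) (U k) => p p' bb BB UU e p0' p0.
  have n0 : 0 < k.+1%:R :> R by rewrite ltr0n.
  move: k.+1%:R n0 e => n n0 e.
  by field; rewrite !gt_eqF.
(* Afterwards both quotients have a denominator containing [pois lam k.+1]. *)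
move=> k /=; rewrite -(poisS lam k).
have pgt := pois_gt0 k.+1 lgt.
have n0 : 0 < k.+1%:R :> R by rewrite ltr0n.
have /andP[T0 T1] := totB k.+1.
have BE : B k.+1 = B k + b k.+1 * pois lam k.+1 by rewrite /B big_nat_recr.
have UE : U k.+1 = U k + pois lam k.+1 by rewrite /U big_nat_recr.
have := @stein_increment_bound k.+1%:R lam (U k) (pois lam k.+1) (1 - U k.+1) (b k.+1)
   (B k) (tot - B k.+1) n0 l0 (ltW pgt).
rewrite -BE -UE [B k.+1 + (tot - _)]addrC subrK => /(_ (le_trans T0 T1) (BU k) (totB _) (b01 _) erefl).
have F2 := pois_tail_le k l0; rewrite -/(U k.+1) -/(U k) in F2.
have -> : 1 - U k.+1 + pois lam k.+1 = 1 - U k by rewrite UE; ring.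
move=> /(_ (pois_cumul_le k l0) F2) bound.
move: (k.+1%:R : R) (pois lam k.+1) n0 pgt bound => n p n0 pgt bound.
have -> : (B k.+1 - tot * U k.+1) / (lam * p) - (B k - tot * U k) / (n * p) =
  (n * (B k.+1 - tot * U k.+1) - lam * (B k - tot * U k)) / (n * p * lam).
  by field; rewrite !gt_eqF.
have q0 : 0 < n * p * lam by rewrite !mulr_gt0.
rewrite normrM (gtr0_norm (_ : 0 < (n * p * lam)^-1)) ?invr_gt0// ler_pdivrMr//.
by rewrite mulrCA mulVf ?gt_eqF// mulr1.
Qed.

Lemma pbin_zero l f : (forall h, h \in l -> h = 0) -> pbin l f = f 0%N.
Proof.
elim: l f => //= h l IH f hl; rewrite (hl h) ?mem_head// mul0r add0r subr0 mul1r.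
by apply: IH => k kl; apply: hl; rewrite inE kl orbT.
Qed.

Lemma pois_sum0 (a : pred nat) N : (0 < N)%N ->
  \sum_(0 <= k < N | a k) pois 0 k = (a 0%N)%:R :> R.
Proof.
case: N => // N _; rewrite big_mkcond big_nat_recl//= big1 => [|k _].
  by rewrite addr0 /pois /exp_coeff /= oppr0 expR0 expr0 fact0 divr1 mulr1; case: (a 0).
by rewrite /pois /exp_coeff /= expr0n !mul0r if_same.
Qed.

(** The Stein factor [lam^-1] meets the sum of the [h * h], which is at most [m * lam]. The case
    [lam = 0], where the solution would divide by 0, is a point mass at 0. As [size l < N], the cut
    at [N] is invisible to the trials. *)
Lemma pbin_poisson l m (a : pred nat) N : prob_seq l -> (forall h, h \in l -> h <= m) ->
  0 <= m -> (size l < N)%N ->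
  `|pbin l (fun k => (a k)%:R) - \sum_(0 <= k < N | a k) pois (\sum_(h <- l) h) k| <= m.
Proof.
move=> pl lm m0 lN; set lam := \sum_(h <- l) h.
have l0 : 0 <= lam by rewrite /lam big_seq sumr_ge0// => h /pl /andP[].
have [lgt|] := ltrP 0 lam; last first.
  move=> lle; have {lle}lam0 : lam = 0 by apply/le_anti; rewrite lle.
  rewrite lam0 pois_sum0 ?(leq_trans _ lN)// pbin_zero ?subrr ?normr0// => h hl.
  have [h0 _] := andP (pl _ hl); apply/le_anti; rewrite h0 andbT -lam0 /lam.
  by rewrite (big_rem h)//= lerDl big_seq sumr_ge0// => k /mem_rem/pl/andP[].
have [g [ge gb]] := stein_solution a N lgt.
have := stein_pbin pl gb; rewrite -/lam -pbinZ -pbinB.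
rewrite (_ : pbin l _ = pbin l (fun k => (a k)%:R) - \sum_(0 <= k < N | a k) pois lam k).
  move/le_trans; apply; rewrite mulrC ler_pdivrMr// /lam mulr_sumr.
  rewrite big_seq [leRHS]big_seq; apply: ler_sum => h hl.
  by rewrite ler_wpM2r ?lm//; case/andP: (pl _ hl).
rewrite -(pbin_const l (\sum_(0 <= k < N | a k) _)) -pbinB.
by apply: pbin_eq => k kl; rewrite ge (leq_ltn_trans kl lN) andbT.
Qed.

(* The missing mass is added as one more parameter of the Poisson-binomial law. *)
Lemma pbin_poisson_shift l m (a : pred nat) N lam :
  prob_seq l -> (forall h, h \in l -> h <= m) -> 0 <= m -> ((size l).+1 < N)%N ->
  \sum_(h <- l) h <= lam ->
  `|pbin l (fun k => (a k)%:R) - \sum_(0 <= k < N | a k) pois lam k| <=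
     m + (lam - \sum_(h <- l) h) *+ 2.
Proof.
move=> pl lm m0 lN llam; set d := lam - _.
have d0 : 0 <= d by rewrite subr_ge0.
set P := \sum_(0 <= k < N | a k) _.
have lam0 : 0 <= lam.
  by apply: le_trans llam; rewrite big_seq sumr_ge0// => h /pl /andP[].
have P01 : 0 <= P <= 1.
  rewrite sumr_ge0/=; last by move=> k _; apply: pois_ge0.
  apply: le_trans (pois_sum_le1 N lam0); rewrite /P big_mkcond; apply: ler_sum => k _.
  by case: ifP => // _; apply: pois_ge0.
set B := pbin l _.
have B01 f : (forall k, 0 <= f k <= 1) -> 0 <= pbin l f <= 1.
  move=> f01; rewrite -{1}(pbin_const l 0) -(pbin_const l 1).
  by rewrite !pbin_le// => k; case/andP: (f01 k).
have a01 k : 0 <= ((a k)%:R : R) <= 1 by rewrite ler0n lern1 leq_b1.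
have /andP[B0 B1] : 0 <= B <= 1 by apply: B01.
set B' := pbin l (fun k => (a k.+1)%:R).
have /andP[B0' B1'] : 0 <= B' <= 1 by apply: B01 => k; apply: a01.
case/andP: P01 => P0 P1; rewrite mulr2n ler_norml.
(* For [d > 1] the extra parameter is no probability, but two numbers in [[0, 1]] then differ by
   less than [d]. *)
have [d1|d1] := ltrP 1 d.
  by clearbody d P B; apply/andP; split; lra.
have pdl : prob_seq (d :: l).
  by move=> h; rewrite inE => /predU1P[->|/pl//]; rewrite d0.
have dlm : forall h, h \in d :: l -> h <= m + d.
  by move=> h; rewrite inE => /predU1P[->|/lm hm]; [rewrite lerDr|apply: ler_wpDr].
(* The enlarged list has mean exactly [lam] and parameters at most [m + d]; dropping the extra trial
   costs another [d]. *)
have := @pbin_poisson (d :: l) (m + d) a N pdl dlm (addr_ge0 m0 d0) lN.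
rewrite big_cons {2}/d subrK -/P /= -/B -/B' ler_norml => /andP[H1 H2].
have : `|d * (B - B')| <= d.
  rewrite normrM ger0_norm// ler_piMr// ler_norml.
  by clearbody B B'; apply/andP; split; lra.
rewrite ler_norml => /andP[H3 H4].
clearbody d P B B'.
by apply/andP; split; lra.
Qed.

End PoissonReal.

(** * Riesz spaces *)

Section RieszTheory.
Variables (R : realType) (E : rieszSpaceType R).
Implicit Types (x y z t u v w p d : E) (S : set E).

Lemma rsub_ge0 x y : (0 <= y - x) = (x <= y).
Proof.
apply/idP/idP => h.
  by have := rsp_leD2r _ _ x h; rewrite add0r subrK.
by have := rsp_leD2r _ _ (- x) h; rewrite subrr.
Qed.

Lemma rleD x y z t : x <= y -> z <= t -> x + z <= y + t.
Proof.
move=> xy zt; apply: (le_trans (rsp_leD2r _ _ z xy)).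
by rewrite addrC [y + t]addrC; apply: rsp_leD2r.
Qed.

Lemma raddr_ge0 x y : 0 <= x -> 0 <= y -> 0 <= x + y.
Proof. by move=> x0 y0; rewrite -[0]addr0; apply: rleD. Qed.

Lemma rleD2r z x y : (x + z <= y + z) = (x <= y).
Proof. by rewrite -[LHS]rsub_ge0 opprD addrACA subrr addr0 rsub_ge0. Qed.

Lemma rleD2l z x y : (z + x <= z + y) = (x <= y).
Proof. by rewrite ![z + _]addrC rleD2r. Qed.

Lemma rleN2 x y : (- x <= - y) = (y <= x).
Proof. by rewrite -[LHS]rsub_ge0 opprK addrC rsub_ge0. Qed.

Lemma rle_subl x y z : (x - z <= y) = (x <= y + z).
Proof. by rewrite -[LHS](rleD2r z) subrK. Qed.

Lemma rle_subr x y z : (x <= y - z) = (x + z <= y).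
Proof. by rewrite -[LHS](rleD2r z) subrK. Qed.

Lemma roppr_le0 x : (- x <= 0) = (0 <= x).
Proof. by rewrite -[X in _ <= X]oppr0 rleN2. Qed.

Lemma roppr_ge0 x : (0 <= - x) = (x <= 0).
Proof. by rewrite -[X in X <= _]oppr0 rleN2. Qed.

Lemma rler_wpDr x y z : 0 <= z -> x <= y -> x <= y + z.
Proof. by move=> z0 xy; rewrite -[x]addr0; apply: rleD. Qed.

Lemma rlerB x y z t : x <= y -> t <= z -> x - z <= y - t.
Proof. by move=> xy tz; apply: rleD => //; rewrite rleN2. Qed.

Lemma rscale_le (a : R) x y : 0 <= a -> x <= y -> a *: x <= a *: y.
Proof.
by move=> a0 xy; rewrite -rsub_ge0 -scalerBr rsp_scale_ge0 // rsub_ge0.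
Qed.

Lemma rscale_le_l (a b : R) x : 0 <= x -> a <= b -> a *: x <= b *: x.
Proof.
by move=> x0 ab; rewrite -rsub_ge0 -scalerBl rsp_scale_ge0 // subr_ge0.
Qed.

Lemma rscale_leP (a : R) x y : 0 < a -> (a *: x <= a *: y) = (x <= y).
Proof.
move=> a0; apply/idP/idP => [h|]; last by apply: rscale_le; rewrite ltW.
have := rscale_le (ltW (_ : 0 < a^-1)) h; rewrite invr_gt0 => /(_ a0).
by rewrite !scalerA mulVf ?gt_eqF// !scale1r.
Qed.

Lemma rmulrn_ge0 x n : 0 <= x -> 0 <= x *+ n.
Proof. by move=> x0; rewrite -scaler_nat rsp_scale_ge0. Qed.

Lemma rsum_ge0 (I : Type) (r : seq I) (P : pred I) (f : I -> E) :
  (forall i, P i -> 0 <= f i) -> 0 <= \sum_(i <- r | P i) f i.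
Proof. by move=> f0; elim/big_rec: _ => // i x Pi; apply/raddr_ge0/f0. Qed.

Lemma rler_sum (I : Type) (r : seq I) (P : pred I) (f g : I -> E) :
  (forall i, P i -> f i <= g i) ->
  \sum_(i <- r | P i) f i <= \sum_(i <- r | P i) g i.
Proof.
move=> fg; rewrite -rsub_ge0 -sumrB; apply: rsum_ge0 => i Pi.
by rewrite rsub_ge0 fg.
Qed.

Lemma rmeet_lel x y : rmeet x y <= x.
Proof. by have := lexx (rmeet x y); rewrite rmeetP => /andP[]. Qed.

Lemma rmeet_ler x y : rmeet x y <= y.
Proof. by have := lexx (rmeet x y); rewrite rmeetP => /andP[]. Qed.

Lemma rjoin_gel x y : x <= rjoin x y.
Proof. by have := lexx (rjoin x y); rewrite rjoinP => /andP[]. Qed.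

Lemma rjoin_ger x y : y <= rjoin x y.
Proof. by have := lexx (rjoin x y); rewrite rjoinP => /andP[]. Qed.

Lemma rmeetC x y : rmeet x y = rmeet y x.
Proof. by apply/le_anti; rewrite !rmeetP !rmeet_lel !rmeet_ler. Qed.

Lemma rjoin_le x y z : x <= z -> y <= z -> rjoin x y <= z.
Proof. by move=> xz yz; rewrite rjoinP xz. Qed.

Lemma rmeet_ge x y z : z <= x -> z <= y -> z <= rmeet x y.
Proof. by move=> xz yz; rewrite rmeetP xz. Qed.

Lemma rabs_leP x y : (rabs x <= y) = (x <= y) && (- x <= y).
Proof. by rewrite /rabs rjoinP. Qed.

Lemma rle_abs x : x <= rabs x.
Proof. exact: rjoin_gel. Qed.

Lemma rleN_abs x : - x <= rabs x.
Proof. exact: rjoin_ger. Qed.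

Lemma rge0_double x : 0 <= x + x -> 0 <= x.
Proof.
have h2 : (0 : R) < 2%:R^-1 by rewrite invr_gt0 ltr0Sn.
rewrite -mulr2n -scaler_nat => h; rewrite -(scale1r x) -(@mulVf _ (2%:R : R)) ?pnatr_eq0//.
by rewrite -scalerA; apply: rsp_scale_ge0 => //; apply: ltW.
Qed.

Lemma rabs_le_ge0 x y : rabs x <= y -> 0 <= y.
Proof.
rewrite rabs_leP => /andP[h1 h2]; apply: rge0_double.
by have := rleD h1 h2; rewrite subrr.
Qed.

Lemma rabs_leD x y z t : rabs x <= z -> rabs y <= t -> rabs (x + y) <= z + t.
Proof.
rewrite !rabs_leP opprD => /andP[h1 h2] /andP[h3 h4].
by apply/andP; split; apply: rleD.
Qed.

Definition rpos x := rjoin x 0.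
Definition rneg x := rjoin (- x) 0.

Lemma rpos_ge0 x : 0 <= rpos x. Proof. exact: rjoin_ger. Qed.
Lemma rneg_ge0 x : 0 <= rneg x. Proof. exact: rjoin_ger. Qed.

Lemma rposBneg x : rpos x - rneg x = x.
Proof.
suff -> : rneg x = rpos x - x by rewrite opprB addrC subrK.
apply/le_anti; rewrite rjoin_le /=; last 2 first.
- by rewrite rle_subr addNr; apply: rpos_ge0.
- by rewrite rsub_ge0; apply: rjoin_gel.
rewrite rle_subl; apply: rjoin_le.
  by rewrite -rle_subl subrr rneg_ge0.
by rewrite -rle_subl sub0r; apply: rjoin_gel.
Qed.

Lemma rmeet_pos_neg x : rmeet (rpos x) (rneg x) = 0.
Proof.
apply/le_anti; rewrite [X in _ && X]rmeet_ge ?rpos_ge0 ?rneg_ge0// andbT.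
have e : rneg x = rpos x - x by rewrite -{3}(rposBneg x) opprB addrCA subrr addr0.
set m := rmeet _ _.
suff : rpos x <= rpos x - m by rewrite -{1}(addr0 (rpos x)) rleD2l roppr_ge0.
apply: rjoin_le; last by rewrite rsub_ge0; apply: rmeet_lel.
by rewrite rle_subr addrC -rle_subr -e; apply: rmeet_ler.
Qed.

(* [d + z - p <= d] and [d + z - p <= z]. *)
Lemma disjoint_add_le d z p : rmeet d z = 0 -> d <= p -> z <= p -> d + z <= p.
Proof.
move=> dz dp zp; rewrite -rsub_ge0 -roppr_le0 opprB -dz.
by apply: rmeet_ge; rewrite rle_subl ?rleD2l // addrC rleD2l.
Qed.

(** The summands are removed in turn: [t - d] lies below [p] and [w], and then [t] lies below [d]
    and [w]. *)
Lemma disjoint_le_add t p d w : 0 <= d -> rmeet p w = 0 -> rmeet d w = 0 ->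
  t <= p + d -> t <= w -> t <= 0.
Proof.
move=> d0 pw dw tpd tw.
have h : t - d <= 0.
  rewrite -pw; apply: rmeet_ge; first by rewrite rle_subl.
  by rewrite rle_subl; apply: rler_wpDr.
by rewrite -dw; apply: rmeet_ge => //; rewrite -rsub_ge0 -roppr_le0 opprB.
Qed.

(** The supremum [m] of the multiples of [x] satisfies [m <= m - x]. *)
Lemma archimedean_le0 (x y : E) : dedekind_complete E ->
  (forall n, x *+ n <= y) -> x <= 0.
Proof.
move=> DC h.
have [] := DC [set x *+ n | n in setT]; first by [].
- by exists 0, 0%N.
- by exists y; split => // _ [n _ <-].
move=> m [_ ub lub].
have : m <= m - x.
  apply: lub => // _ [n _ <-]; rewrite rle_subr -mulrSr; apply: ub.
  by exists n.+1.
by rewrite -{1}(addr0 m) rleD2l roppr_ge0.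
Qed.

Lemma archimedean_eps (x y : E) : dedekind_complete E ->
  (forall eps : R, 0 < eps -> x <= eps *: y) -> x <= 0.
Proof.
move=> DC h; apply: (archimedean_le0 (y := rpos y)) => // -[|n]; first by rewrite mulr0n rpos_ge0.

have n0 : (0 : R) < n.+1%:R^-1 by rewrite invr_gt0 ltr0Sn.
rewrite -scaler_nat -(rscale_leP _ _ n0) scalerA mulVf ?pnatr_eq0// scale1r.
by apply: (le_trans (h _ n0)); apply: rscale_le (ltW n0) (rjoin_gel _ _).
Qed.

End RieszTheory.

(** * Order convergence of sequences *)

Section OrderConvergence.
Variables (R : realType) (E : rieszSpaceType R).
Implicit Types (f g x y : nat -> E) (l b : E) (A : set nat).

Definition seq_cvg x l := order_cvg (fun m n : nat => (m <= n)%N) x l.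
Definition nondecr x := forall n, x n <= x n.+1.

Lemma nondecr_le x m n : nondecr x -> (m <= n)%N -> x m <= x n.
Proof.
move=> xS; elim: n => [|n IH]; first by rewrite leqn0 => /eqP ->.
by rewrite leq_eqVlt => /orP[/eqP -> //|/IH h]; apply: le_trans h (xS n).
Qed.

Lemma inf0_add (y y' : nat -> E) :
  (forall m n, (m <= n)%N -> y n <= y m) ->
  (forall m n, (m <= n)%N -> y' n <= y' m) ->
  infimums (range y) 0 -> infimums (range y') 0 ->
  infimums (range (fun n => y n + y' n)) 0.
Proof.
move=> dy dy' [y0 y1] [y0' y1']; split.
  move=> _ [n _ <-]; apply: raddr_ge0; first by apply: y0; exists n.
  by apply: y0'; exists n.
move=> b lb; apply: y1 => _ [n _ <-].
rewrite -rsub_ge0 -roppr_le0 opprB; apply: y1' => _ [m _ <-].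
rewrite rle_subl; apply: (@le_trans _ _ (y (maxn n m) + y' (maxn n m))).
  by apply: lb; exists (maxn n m).
by rewrite addrC; apply: rleD; [apply: dy'|apply: dy]; rewrite ?leq_maxl ?leq_maxr.
Qed.

Lemma seq_cvg_le x l b N : seq_cvg x l -> (forall n, (N <= n)%N -> x n <= b) -> l <= b.
Proof.
move=> [y [dy [_ y1] xy]] xb.
rewrite -rsub_ge0 -roppr_le0 opprB; apply: y1 => _ [n _ <-].
apply: (@le_trans _ _ (y (maxn n N))); last by apply: dy; rewrite leq_maxl.
have := xy (maxn n N); rewrite rabs_leP opprB => /andP[_].
apply: le_trans; apply: rlerB => //; apply: xb; exact: leq_maxr.
Qed.

Lemma seq_cvg_ge x l b N : seq_cvg x l -> (forall n, (N <= n)%N -> b <= x n) -> b <= l.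
Proof.
move=> [y [dy [_ y1] xy]] xb.
rewrite -rsub_ge0 -roppr_le0 opprB; apply: y1 => _ [n _ <-].
apply: (@le_trans _ _ (y (maxn n N))); last by apply: dy; rewrite leq_maxl.
have := xy (maxn n N); rewrite rabs_leP => /andP[+ _].
apply: le_trans; apply: rlerB => //; apply: xb; exact: leq_maxr.
Qed.

Lemma sup_seq_cvg x l : nondecr x -> supremums (range x) l -> seq_cvg x l.
Proof.
move=> xS [ub lub]; exists (fun n => l - x n); split.
- by move=> m n mn; apply: rlerB => //; apply: nondecr_le.
- split; first by move=> _ [n _ <-]; rewrite rsub_ge0; apply: ub; exists n.
  move=> b lb; rewrite -roppr_ge0 -(rleD2l l) addr0; apply: lub => _ [n _ <-].
  by rewrite rle_subr addrC -rle_subr; apply: lb; exists n.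
move=> n; rewrite rabs_leP opprB lexx andbT.
have h : x n <= l by apply: ub; exists n.
by apply: (@le_trans _ _ 0); rewrite ?rsub_ge0// -roppr_ge0 opprB rsub_ge0.
Qed.

Lemma seq_cvg_ub x l n : nondecr x -> seq_cvg x l -> x n <= l.
Proof. by move=> xS xl; apply: (seq_cvg_ge xl) => m; apply: nondecr_le. Qed.

Lemma seq_cvgB x x' l l' :
  seq_cvg x l -> seq_cvg x' l' -> seq_cvg (fun n => x n - x' n) (l - l').
Proof.
move=> [y [dy iy xy]] [y' [dy' iy' xy']]; exists (fun n => y n + y' n); split.
- by move=> m n mn; apply: rleD; [apply: dy|apply: dy'].
- exact: inf0_add.
move=> n; have := xy n; have := xy' n; rewrite !rabs_leP => /andP[a b] /andP[c d].
have -> /= : x n - x' n - (l - l') = (x n - l) - (x' n - l').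
  by rewrite !opprB addrACA [RHS]addrACA [- l + _]addrC.
apply/andP; split; first exact: rleD.
by rewrite opprD; apply: rleD => //; rewrite opprK.
Qed.

Lemma seq_cvg_unique x l l' : seq_cvg x l -> seq_cvg x l' -> l = l'.
Proof.
have h : forall l l', seq_cvg x l -> seq_cvg x l' -> l <= l'.
  move=> {}l {}l' xl xl'; rewrite -rsub_ge0.
  have := seq_cvgB xl' xl => c; apply: (seq_cvg_ge (N := 0) c) => n _.
  by rewrite subrr.
by move=> xl xl'; apply/le_anti; rewrite !h.
Qed.

Lemma nondecr_bounded_sup x b : dedekind_complete E -> (forall n, x n <= b) ->
  exists l, supremums (range x) l.
Proof.
move=> DC xb; have [] := DC (range x); first by [].
- by exists (x 0%N), 0%N.
- by exists b; split => // _ [n _ <-].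
by move=> l [_ ub lub]; exists l; split => // c; apply: lub.
Qed.

Lemma nondecr_bounded_cvg x b : dedekind_complete E -> nondecr x ->
  (forall n, x n <= b) -> exists l, seq_cvg x l.
Proof.
move=> DC xS xb; have [l xl] := nondecr_bounded_sup DC xb.
by exists l; apply: sup_seq_cvg.
Qed.

Lemma partial_sumS A f n :
  partial_sum A f n.+1 = partial_sum A f n + (if n \in A then f n else 0).
Proof. by rewrite /partial_sum big_mkcond big_nat_recr//= -big_mkcond. Qed.

Lemma partial_sum0 A f : partial_sum A f 0 = 0.
Proof. by rewrite /partial_sum big_geq. Qed.

Lemma partial_sum_nondecr A f : (forall k, 0 <= f k) -> nondecr (partial_sum A f).
Proof.
move=> f0 n; rewrite partial_sumS; apply: rler_wpDr => //.
by case: ifP.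
Qed.

Lemma partial_sum_le_setT A f n : (forall k, 0 <= f k) ->
  partial_sum A f n <= partial_sum setT f n.
Proof.
move=> f0; rewrite /partial_sum big_mkcond [leRHS]big_mkcond.
by apply: rler_sum => k _; rewrite in_setT; case: ifP.
Qed.

Lemma order_sum_eq A f l : order_sums A f l -> order_sum A f = l.
Proof. by move=> fl; apply: xget_unique => // l' /seq_cvg_unique; apply. Qed.

Lemma order_sumsP A f : (exists l, order_sums A f l) -> order_sums A f (order_sum A f).
Proof. exact: xgetPex. Qed.

(** The positive and the negative parts of [f] have increasing partial sums below [b]. *)
Lemma order_sums_exists A f g b : dedekind_complete E ->
  (forall k, 0 <= g k) -> (forall k, rabs (f k) <= g k) ->
  (forall n, partial_sum setT g n <= b) -> exists l, order_sums A f l.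
Proof.
move=> DC g0 fg gb.
have pb (h : nat -> E) : (forall k, 0 <= h k <= g k) -> exists l, order_sums A h l.
  move=> hg; apply: (nondecr_bounded_cvg (b := b) DC).
    by apply: partial_sum_nondecr => k; case/andP: (hg k).
  move=> n; apply: (le_trans _ (gb n)).
  apply: (le_trans (partial_sum_le_setT _ _ _)).
    by move=> k; case/andP: (hg k).
  by apply: rler_sum => k _; case/andP: (hg k).
have [k|l hl] := pb (fun k => rpos (f k)).
  rewrite rpos_ge0 rjoin_le//; exact: (le_trans (rle_abs _)).
have [k|l' hl'] := pb (fun k => rneg (f k)).
  rewrite rneg_ge0 rjoin_le//; exact: (le_trans (rleN_abs _)).
exists (l - l').
have := seq_cvgB hl hl'; congr order_cvg; apply/funext => n.
by rewrite /partial_sum -sumrB; apply: eq_bigr => k _; rewrite rposBneg.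
Qed.

End OrderConvergence.

(** * Idempotents of an f-algebra *)

(* The product of an [fAlgebraType] lies outside the library's ring hierarchy,
   hence the non-forgetful instance. *)
#[non_forgetful_inheritance, warnings="-redundant-canonical-projection"]
HB.instance Definition _ (R : realType) (A : fAlgebraType R) :=
  GRing.Zmodule_isComPzRing.Build (FAlgebra.sort A)
    (@fmulA R A) (@fmulC R A) (@fmul1 R A) (@fmulDl R A).

(** Scalars enter through a ring morphism, so that [ring] treats them like elements. *)
Definition fconst (R : realType) (A : fAlgebraType R) (c : R) : A := c *: (1 : A).

Lemma fconst_is_zmod_morphism (R : realType) (A : fAlgebraType R) :
  zmod_morphism (@fconst R A).
Proof. by move=> a b; rewrite /fconst scalerBl. Qed.

Lemma fscalerAl (R : realType) (A : fAlgebraType R) (c : R) (x y : A) :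
  c *: (x * y) = (c *: x) * y.
Proof. by rewrite [RHS]fmulZl. Qed.

Lemma fconst_is_monoid_morphism (R : realType) (A : fAlgebraType R) :
  monoid_morphism (@fconst R A).
Proof.
split; first by rewrite /fconst scale1r.
by move=> a b; rewrite /fconst -fscalerAl mul1r scalerA.
Qed.

HB.instance Definition _ (R : realType) (A : fAlgebraType R) :=
  GRing.isZmodMorphism.Build R A (@fconst R A) (@fconst_is_zmod_morphism R A).
HB.instance Definition _ (R : realType) (A : fAlgebraType R) :=
  GRing.isMonoidMorphism.Build R A (@fconst R A) (@fconst_is_monoid_morphism R A).

Section FAlgebraTheory.
Variables (R : realType) (A : fAlgebraType R).
Implicit Types (x y z w p q H : A) (c d : R).
Local Notation K := (@fconst R A).

Lemma foneE : fone = 1 :> A. Proof. by []. Qed.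
Lemma fmulE x y : fmul x y = x * y. Proof. by []. Qed.
Lemma fscaleE c x : c *: x = K c * x. Proof. by rewrite /fconst -fscalerAl mul1r. Qed.

Lemma fmulr_ge0 x y : 0 <= x -> 0 <= y -> 0 <= x * y.
Proof. exact: fmul_ge0. Qed.

Lemma flerM2l z x y : 0 <= z -> x <= y -> z * x <= z * y.
Proof. by move=> z0 xy; rewrite -rsub_ge0 -mulrBr fmulr_ge0// rsub_ge0. Qed.

(** Using the f-algebra axiom once in each factor makes [x * y] disjoint from itself. *)
Lemma disjoint_mul0 x y : rmeet x y = 0 -> x * y = 0.
Proof.
move=> xy.
have x0 : 0 <= x by rewrite -xy rmeet_lel.
have y0 : 0 <= y by rewrite -xy rmeet_ler.
have h1 := fmul_disjoint _ _ _ xy y0.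
rewrite rmeetC in h1; have h2 := fmul_disjoint _ _ _ h1 x0.
apply/le_anti; rewrite fmulr_ge0// andbT -h2 [fmul y x]fmulC.
exact: rmeet_ge.
Qed.

Lemma fsqr_ge0 x : 0 <= x * x.
Proof.
have h := disjoint_mul0 (rmeet_pos_neg x).
rewrite -(rposBneg x).
have -> : (rpos x - rneg x) * (rpos x - rneg x) =
  rpos x * rpos x + rneg x * rneg x - (rpos x * rneg x + rpos x * rneg x) by ring.
rewrite h addr0 subr0; apply: raddr_ge0; apply: fmulr_ge0; exact: rpos_ge0 || exact: rneg_ge0.
Qed.

Lemma fone_ge0 : 0 <= 1 :> A.
Proof. by rewrite -(mulr1 1); apply: fsqr_ge0. Qed.

Lemma fconst_ge0 c : 0 <= c -> 0 <= K c.
Proof. by move=> c0; apply: rsp_scale_ge0 => //; apply: fone_ge0. Qed.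

Lemma fconst_le c d : c <= d -> K c <= K d.
Proof. by move=> cd; apply: rscale_le_l => //; apply: fone_ge0. Qed.

Definition idem p := p * p = p.
Definition nzidem p := idem p /\ p <> 0.

Lemma idem_ge0 p : idem p -> 0 <= p.
Proof. by move=> <-; apply: fsqr_ge0. Qed.

Lemma idem1 : idem 1. Proof. exact: mulr1. Qed.

Lemma idemC p : idem p -> idem (1 - p).
Proof. by rewrite /idem => pp; rewrite mulrBl mul1r mulrBr mulr1 pp subrr subr0. Qed.

Lemma idem_le1 p : idem p -> p <= 1.
Proof. by move/idemC/idem_ge0; rewrite rsub_ge0. Qed.

Lemma idemM p q : idem p -> idem q -> idem (p * q).
Proof. by rewrite /idem => pp qq; rewrite mulrACA pp qq. Qed.

Lemma idem_mul_meet p q : idem p -> idem q -> p * q = rmeet p q.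
Proof.
move=> pp qq; apply/le_anti/andP; split.
  apply: rmeet_ge.
    by rewrite -[leRHS]mulr1; apply: flerM2l (idem_ge0 pp) (idem_le1 qq).
  by rewrite -[leRHS]mulr1 mulrC; apply: flerM2l (idem_ge0 qq) (idem_le1 pp).
set z := rmeet p q.
have -> : z = p * z + (1 - p) * z by ring.
rewrite -[leRHS]addr0; apply: rleD.
  by apply: flerM2l (idem_ge0 pp) (rmeet_ler _ _).
apply: le_trans (flerM2l (idem_ge0 (idemC pp)) (rmeet_lel _ _)) _.
by rewrite mulrBl pp mul1r subrr.
Qed.

Lemma component_idem p : is_component fone p <-> idem p.
Proof.
split=> [[_ /disjoint_mul0]|pp].
  by rewrite foneE mulrBl mul1r => /eqP; rewrite subr_eq0 => /eqP /esym.
split; first by rewrite idem_ge0//= foneE idem_le1.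
by rewrite foneE -idem_mul_meet ?mulrBl ?mul1r ?pp ?subrr//; apply: idemC.
Qed.

Hypothesis DC : dedekind_complete A.

(** [p] plays the event [[y >= 0]], with an unspecified choice where [y] vanishes. It is the
    supremum of the elements of [[0, 1]] disjoint from the negative part; maximality makes [1 - p]
    disjoint from [p] and from the positive part. *)
Lemma spectral y : exists p, [/\ idem p, 0 <= p * y & (1 - p) * y <= 0].
Proof.
pose w := rneg y.
pose S := [set z : A | [/\ 0 <= z, z <= 1 & rmeet z w = 0]].
have S0 : S 0.
  split; rewrite ?fone_ge0//; apply/le_anti.
  by rewrite rmeet_lel rmeet_ge// rneg_ge0.
have [] := @DC S; first by [].
- by exists 0.
- by exists 1; split => // z [].
move=> p [_ ub lub].
have p0 : 0 <= p by apply: ub.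
have p1 : p <= 1 by apply: lub => // z [].
have pw : rmeet p w = 0.
  (* Every [z] in [S] is disjoint from [d], hence [d + z <= p]; so [p - d] is an upper bound too and
     [d = 0]. *)
  set d := rmeet p w.
  have d0 : 0 <= d by apply: rmeet_ge => //; apply: rneg_ge0.
  apply/le_anti; rewrite d0 andbT -roppr_ge0 -(rleD2l p) addr0.
  apply: lub => // z Sz; rewrite rle_subr addrC.
  apply: disjoint_add_le; [|exact: rmeet_lel|exact: ub].
  case: Sz => z0 _ zw; apply/le_anti; rewrite [X in _ && X]rmeet_ge// andbT -zw.
  by apply: rmeet_ge; [exact: rmeet_ler|apply: le_trans (rmeet_lel _ _) (rmeet_ler _ _)].
(* [p] is the largest element of [0, 1] disjoint from [w]. *)
have maxp (d : A) : 0 <= d -> d <= 1 - p -> rmeet d w = 0 -> d = 0.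
  move=> d0 dp dw; apply/le_anti; rewrite d0 andbT -(rleD2l p) addr0.
  apply: ub; split; rewrite ?raddr_ge0//; first by rewrite addrC -rle_subr.
  apply/le_anti; rewrite [X in _ && X]rmeet_ge ?raddr_ge0 ?rneg_ge0// andbT.
  exact: (disjoint_le_add d0 pw dw (rmeet_lel _ _) (rmeet_ler _ _)).
have dis0 (d z : A) : 0 <= d -> d <= z -> rmeet z w = 0 -> rmeet d w = 0.
  move=> d0 dz zw; apply/le_anti; rewrite [X in _ && X]rmeet_ge ?rneg_ge0// andbT.
  rewrite -zw; apply: rmeet_ge; last exact: rmeet_ler.
  exact: le_trans (rmeet_lel _ _) dz.
have h1 : (1 - p) * p = 0.
  have g0 : 0 <= rmeet (1 - p) p by rewrite rmeet_ge// rsub_ge0.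
  apply/disjoint_mul0/maxp => //; first exact: rmeet_lel.
  exact: dis0 g0 (rmeet_ler _ _) pw.
have h2 : (1 - p) * rpos y = 0.
  have g0 : 0 <= rmeet (1 - p) (rpos y) by rewrite rmeet_ge ?rpos_ge0// rsub_ge0.
  apply/disjoint_mul0/maxp => //; first exact: rmeet_lel.
  exact: dis0 g0 (rmeet_ler _ _) (rmeet_pos_neg y).
have h3 := disjoint_mul0 pw; exists p; split.
- by move: h1; rewrite mulrBl mul1r => /eqP; rewrite subr_eq0 => /eqP/esym.
- by rewrite -(rposBneg y) mulrBr h3 subr0; apply: fmulr_ge0 => //; apply: rpos_ge0.
- rewrite -(rposBneg y) mulrBr h2 sub0r roppr_le0 fmulr_ge0 ?rneg_ge0//.
  by rewrite rsub_ge0.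
Qed.

Lemma fconst_mul_le0 c x : 0 < c -> K c * x <= 0 -> x <= 0.
Proof. by move=> c0; rewrite -fscaleE => h; rewrite -(rscale_leP _ _ c0) scaler0. Qed.

Lemma nzidem_nle0 p : nzidem p -> ~ p <= 0.
Proof. by move=> [pp p0] h; apply: p0; apply/le_anti; rewrite h idem_ge0. Qed.

Lemma nzidem_const_lt p c d : nzidem p -> K c * p <= K d * p -> c <= d.
Proof.
move=> np h; rewrite leNgt; apply/negP => dc; apply: (nzidem_nle0 np).
apply: (@fconst_mul_le0 (c - d)); first by rewrite subr_gt0.
by rewrite rmorphB mulrBl -roppr_ge0 opprB rsub_ge0.
Qed.

(** By the Archimedean property [x - y] already fails to lie below some constant [e]; the spectral
    idempotent of [x - y - e] is then nonzero. *)
Lemma not_le_idem x y : ~ x <= y ->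
  exists p (e : R), [/\ nzidem p, 0 < e & K e * p <= p * (x - y)].
Proof.
move=> nxy.
have [e e0 he] : exists2 e : R, 0 < e & ~ x - y <= K e.
  apply: contrapT => h; apply: nxy; rewrite -rsub_ge0 -roppr_le0 opprB.
  apply: (archimedean_eps (y := (1 : A)) DC) => e e0; apply: contrapT => ne.
  by apply: h; exists e.
have [p [pp h1 h2]] := spectral (x - y - K e).
exists p, e; split => //; last first.
  by rewrite -rsub_ge0 [K e * p]mulrC -mulrBr.
split => // p0; apply: he; move: h2.
by rewrite p0 subr0 mul1r -roppr_ge0 opprB rsub_ge0.
Qed.

(** For idempotents [p' * p = p'] means [p' <= p]; a property holding on such a [p'] below every
    nonzero [p] holds densely. *)
Definition sub_nz p' p := nzidem p' /\ p' * p = p'.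

Lemma sub_nz_refl p : nzidem p -> sub_nz p p.
Proof. by move=> np; split => //; case: np. Qed.

Lemma sub_nz_trans p q r : sub_nz p q -> sub_nz q r -> sub_nz p r.
Proof. by move=> [np pq] [nq qr]; split => //; rewrite -pq -mulrA qr. Qed.

Lemma sub_nz_mul p q : idem p -> idem q -> p * q <> 0 -> sub_nz (p * q) p.
Proof.
move=> pp qq pq; split; first by split => //; apply: idemM.
by rewrite mulrC mulrA pp.
Qed.

Lemma sub_nz_mulr p q : idem p -> idem q -> p * q <> 0 -> sub_nz (p * q) q.
Proof. by move=> pp qq; rewrite mulrC; apply: sub_nz_mul. Qed.

Lemma sub_nz_le p' p x y : sub_nz p' p -> p * x <= p * y -> p' * x <= p' * y.
Proof.
move=> [[pp _] e] h; rewrite -e -!mulrA; apply: flerM2l => //; exact: idem_ge0.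
Qed.

Lemma sub_nz_eq p' p x y : sub_nz p' p -> p * x = p * y -> p' * x = p' * y.
Proof. by move=> [_ e] h; rewrite -e -!mulrA h. Qed.

(** A dense family of idempotents decides inequalities: the gap given by [not_le_idem] persists on
    every smaller idempotent. *)
Lemma local_le x y :
  (forall p, nzidem p -> exists2 p', sub_nz p' p & p' * x <= p' * y) -> x <= y.
Proof.
move=> h; apply: contrapT => /not_le_idem[p [e [np e0 he]]].
have [p' s le] := h p np; have [np' e'] := s.
apply: (nzidem_nle0 np'); apply: (fconst_mul_le0 e0); apply: (@le_trans _ _ (p' * (x - y))).
  have := he; rewrite [K e * p]mulrC => /(sub_nz_le s).
  by rewrite [p' * K e]mulrC.
by rewrite mulrBr -roppr_ge0 opprB rsub_ge0.
Qed.

Lemma local_eq x y :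
  (forall p, nzidem p -> exists2 p', sub_nz p' p & p' * x = p' * y) -> x = y.
Proof.
move=> h; apply/le_anti/andP; split; apply: local_le => p /h[p' s e]; exists p' => //;
  by rewrite e.
Qed.

(** If no piece of [p] worked, [y] would exceed every [n] on all of [p], against the Archimedean
    property. *)
Lemma local_bounded y p : nzidem p ->
  exists p' (n : nat), sub_nz p' p /\ p' * y <= p' * K n%:R.
Proof.
move=> np; apply: contrapT => hn; apply: (nzidem_nle0 np).
apply: (archimedean_le0 (y := p * y) DC) => n.
have [c [cc h1 h2]] := spectral (y - K n%:R).
have pc : p * (1 - c) = 0.
  apply: contrapT => pc; apply: hn; exists (p * (1 - c)), n; split.
    by apply: sub_nz_mul => //; [case: np|apply: idemC].
  rewrite -!mulrA; apply: flerM2l; first by apply: idem_ge0; case: np.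
  by rewrite -rsub_ge0 -mulrBr -roppr_le0 -mulrN opprB.
have pe : p * c = p.
  by apply/eqP; rewrite eq_sym -subr_eq0 -{1}(mulr1 p) -mulrBr pc.
rewrite -scaler_nat fscaleE -rsub_ge0.
have -> : p * y - K n%:R * p = p * (c * (y - K n%:R)).
  by rewrite mulrA pe; ring.
by apply: fmulr_ge0 => //; apply: idem_ge0; case: np.
Qed.

End FAlgebraTheory.

(** * Values along an ultrafilter of idempotents *)

Section Ultrafilters.
Variables (R : realType) (A : fAlgebraType R).
Implicit Types (x y z w p q r H : A) (c d e s t : R).
Local Notation K := (@fconst R A).

(** Ultrafilters of the Boolean algebra of idempotents. Upward closure follows: if [p <= q] and
    [1 - q] were a member along with [p], so would be their product 0. *)
Record ultra (U : set A) : Prop := {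
  ultra_idem : forall p, U p -> idem p;
  ultra_n0 : ~ U 0;
  ultraM : forall p q, U p -> U q -> U (p * q);
  ultraC : forall c : A, idem c -> U c \/ U (1 - c)
}.

(** A maximal multiplicative family of idempotents meeting [p]. The empty family qualifies, which
    settles the empty chain in Zorn's lemma. *)
Lemma ultra_exists p : nzidem p -> exists2 U, ultra U & U p.
Proof.
move=> [pp p0].
pose P (F : set A) := (forall f, F f -> idem f /\ p * f <> 0) /\
  (forall f g, F f -> F g -> F (f * g)).
have [F0 C0|F [[Fi FM] Fmax]] := @Zorn_bigcup A P.
  move=> tot; split; first by move=> f [X /C0[h _] /h].
  move=> f g [X FX Xf] [Y FY Yg].
  have [XY|YX] := tot _ _ FX FY.
    by exists Y => //; apply: (C0 _ FY).2 => //; apply: XY.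
  by exists X => //; apply: (C0 _ FX).2 => //; apply: YX.
have Fmem (c : A) : idem c -> p * c <> 0 -> (forall f, F f -> p * (f * c) <> 0) -> F c.
  move=> cc pc Fc; apply: contrapT => nFc.
  apply: (Fmax (F `|` [set c] `|` [set f * c | f in F])).
    split; first by move=> f Ff; left; left.
    by move=> /(_ c) h; apply: nFc; apply: h; left; right.
  split.
    move=> g [[/Fi h|->]|[f Ff <-]]; [exact: h|by split|].
    by split; [apply: idemM => //; case: (Fi _ Ff)|apply: Fc].
  move=> a b [[Ff|->]|[f Ff <-]] [[Fg|->]|[g Fg <-]].
  - by left; left; apply: FM.
  - by right; exists a.
  - by right; exists (a * g); [apply: FM|rewrite mulrA].
  - by right; exists b => //; rewrite mulrC.
  - by rewrite cc; left; right.
  - by right; exists g => //; rewrite mulrCA cc.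
  - by right; exists (f * b); [apply: FM|rewrite mulrAC].
  - by right; exists f => //; rewrite -mulrA cc.
  - by right; exists (f * g); [apply: FM|rewrite mulrACA cc].
have Fp : F p.
  apply: Fmem; rewrite ?pp// => f Ff; rewrite mulrCA pp mulrC.
  by case: (Fi _ Ff).
exists F => //; split => //.
- by move=> f /Fi[].
- by move/Fi => [_]; rewrite mulr0.
move=> c cc; apply: contrapT => /not_orP[nc nC].
(* If [c'] cannot be adjoined, some member [f] has [f * c'] disjoint from [p]. Such members for [c]
   and for [1 - c] have a product disjoint from [p]. *)
have h (c' : A) : idem c' -> ~ F c' -> exists2 f, F f & p * (f * c') = 0.
  move=> cc' nc'; apply: contrapT => hn; apply: nc'; apply: Fmem => //.
    by move=> pc; apply: hn; exists p => //; rewrite mulrA pp.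
  by move=> f Ff pf; apply: hn; exists f.
have [f Ff fc] := h _ cc nc; have [g Fg gc] := h _ (idemC cc) nC.
have [_] := Fi _ (FM _ _ Ff Fg); apply.
have -> : p * (f * g) = p * (f * c) * g + p * (g * (1 - c)) * f by ring.
by rewrite fc gc !mul0r addr0.
Qed.

Definition bnd p x e := p * x <= p * K e /\ - (p * K e) <= p * x.

Lemma bndN p x e : bnd p x e -> bnd p (- x) e.
Proof. by move=> [h1 h2]; split; rewrite mulrN ?rleN2// -rleN2 opprK. Qed.

Lemma bnd_sub p q x e : bnd p x e -> idem q -> bnd (q * p) x e.
Proof.
move=> [h1 h2] /idem_ge0 q0; split; first by rewrite -!mulrA; apply: flerM2l.
by rewrite -!mulrA -mulrN; apply: flerM2l.
Qed.

Lemma bnd_subr p q x e : bnd p x e -> idem q -> bnd (p * q) x e.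
Proof. by rewrite mulrC; apply: bnd_sub. Qed.

Lemma bnd_le p x e d : idem p -> e <= d -> bnd p x e -> bnd p x d.
Proof.
move=> /idem_ge0 p0 ed [h1 h2].
have h : p * K e <= p * K d by apply: flerM2l => //; apply: fconst_le.
by split; [apply: le_trans h|apply: le_trans h2; rewrite rleN2].
Qed.

Lemma bndD p x y e d : bnd p x e -> bnd p y d -> bnd p (x + y) (e + d).
Proof.
move=> [h1 h2] [h3 h4]; split; rewrite rmorphD !mulrDr ?opprD; exact: rleD.
Qed.

Lemma bnd_const p c : idem p -> bnd p (K c) `|c|.
Proof.
move=> /idem_ge0 p0; split; first by apply: flerM2l => //; apply/fconst_le/ler_norm.
rewrite -mulrN -rmorphN; apply: flerM2l => //; apply/fconst_le.
by rewrite lerNl -normrN ler_norm.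
Qed.

(** Absolute values are avoided: twice each gap is a sum of products of nonnegative factors. *)
Lemma bndM p x y e d : idem p -> bnd p x e -> bnd p y d -> bnd p (x * y) (e * d).
Proof.
move=> pp [h1 h2] [h3 h4].
have pM (a b : A) : p * (a * b) = (p * a) * (p * b) by rewrite mulrACA pp.
rewrite /bnd rmorphM !pM; move: h1 h2 h3 h4.
set X := p * x; set Y := p * y; set B := p * K e; set D := p * K d.
rewrite -[X <= B]rsub_ge0 -[- B <= X]rsub_ge0 -[Y <= D]rsub_ge0 -[- D <= Y]rsub_ge0.
move=> h1 h2 h3 h4; split; rewrite -rsub_ge0; apply: rge0_double.
  have -> : B * D - X * Y + (B * D - X * Y) =
    (B - X) * (Y - - D) + (X - - B) * (D - Y) by ring.
  by apply: raddr_ge0; apply: fmulr_ge0.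
have -> : X * Y - - (B * D) + (X * Y - - (B * D)) =
    (B - X) * (D - Y) + (X - - B) * (Y - - D) by ring.
by apply: raddr_ge0; apply: fmulr_ge0.
Qed.

(** A relation and not a function, because an element bounded on no member of [U] has no value. *)
Definition uval (U : set A) y t := forall e, 0 < e -> exists2 p, U p & bnd p (y - K t) e.

Section Values.
Variables (U : set A) (uU : ultra U).
Local Notation Val := (uval U).

Lemma ultra_nz p : U p -> nzidem p.
Proof. by move=> Up; split; [apply: (ultra_idem uU)|move=> p0; apply: (ultra_n0 uU); rewrite -p0]. Qed.

Lemma bnd0 p e : idem p -> 0 <= e -> bnd p 0 e.
Proof.
by move=> pp e0; have := bnd_const 0 pp; rewrite rmorph0 normr0; apply: bnd_le.
Qed.

Lemma uval_local p y t : U p -> p * y = p * K t -> Val y t.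
Proof.
move=> Up pyt e e0; exists p => //.
have pp := ultra_idem uU Up.
have -> : bnd p (y - K t) e = bnd p 0 e by rewrite /bnd mulrBr pyt subrr mulr0.
exact: bnd0 (ltW e0).
Qed.

Lemma ultra1 : U 1.
Proof. by case: (ultraC uU (@idem1 _ A)) => //; rewrite subrr => /(ultra_n0 uU). Qed.

Lemma uval_const t : Val (K t) t.
Proof. exact: (uval_local ultra1). Qed.

Lemma uval0 : Val 0 0.
Proof. by have := uval_const 0; rewrite rmorph0. Qed.

Lemma uval1 : Val 1 1.
Proof. by have := uval_const 1; rewrite rmorph1. Qed.

Lemma uvalD y z s t : Val y s -> Val z t -> Val (y + z) (s + t).
Proof.
move=> hy hz e e0; have e2 : 0 < e / 2 by rewrite divr_gt0.
have [p Up hp] := hy _ e2; have [q Uq hq] := hz _ e2.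
exists (p * q); first exact: (ultraM uU).
rewrite [e]splitr rmorphD opprD addrACA; apply: bndD.
  by apply: bnd_subr => //; apply: (ultra_idem uU).
by apply: bnd_sub => //; apply: (ultra_idem uU).
Qed.

Lemma uvalN y s : Val y s -> Val (- y) (- s).
Proof.
move=> hy e e0; have [p Up hp] := hy _ e0; exists p => //.
by rewrite rmorphN -opprD; apply: bndN.
Qed.

Lemma uvalB y z s t : Val y s -> Val z t -> Val (y - z) (s - t).
Proof. by move=> hy hz; apply: uvalD => //; apply: uvalN. Qed.

Lemma uvalM y z s t : Val y s -> Val z t -> Val (y * z) (s * t).
Proof.
move=> hy hz e e0.
pose m := 1 + `|s| + `|t|.
have m0 : 0 < m by rewrite /m -addrA ltr_pwDl// addr_ge0.
(* With [d <= 1] the error [d * d + (|s| + |t|) * d] is at most [m * d], hence at most [e]. *)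
pose d := Num.min 1 (e / m).
have d0 : 0 < d by rewrite /d lt_min ltr01 divr_gt0.
have [p Up hp] := hy _ d0; have [q Uq hq] := hz _ d0.
have Upq := ultraM uU Up Uq; exists (p * q) => //.
have ip := ultra_idem uU Up; have iq := ultra_idem uU Uq.
have ipq := ultra_idem uU Upq.
have -> : y * z - K (s * t) =
  (y - K s) * (z - K t) + (K s * (z - K t) + K t * (y - K s)) by ring.
have {}hp := bnd_subr hp iq; have {}hq := bnd_sub hq ip.
apply: (@bnd_le _ _ (d * d + (`|s| * d + `|t| * d))) => //.
  apply: (@le_trans _ _ (m * d)).
    rewrite /m !mulrDl mul1r -addrA lerD2r -{3}(mul1r d) ler_pM2r//.
    by rewrite /d ge_min lexx.
  by rewrite mulrC -ler_pdivlMr// /d ge_min lexx orbT.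
apply: bndD; first exact: bndM.
by apply: bndD; apply: bndM => //; apply: bnd_const.
Qed.

(** The inequality is needed only on one member of [U]. For [y = z] this gives uniqueness of
    values. *)
Lemma uval_le p y z s t : U p -> p * y <= p * z -> Val y s -> Val z t -> s <= t.
Proof.
move=> Up pyz hy hz; apply/ler_addgt0Pr => e e0.
have e2 : 0 < e / 2 by rewrite divr_gt0.
have [q Uq [_ hq]] := hy _ e2; have [r Ur [hr _]] := hz _ e2.
have Uw := ultraM uU Up (ultraM uU Uq Ur); set w := p * (q * r) in Uw.
have ip := ultra_idem uU Up; have iq := ultra_idem uU Uq.
have ir := ultra_idem uU Ur.
apply: (nzidem_const_lt (ultra_nz Uw)).
have h1 : w * (K s - K (e / 2)) <= w * y.
  have -> : w * (K s - K (e / 2)) = p * r * (- (q * K (e/2)) + q * K s) by rewrite /w; ring.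
  have -> : w * y = p * r * (q * (y - K s) + q * K s) by rewrite /w; ring.
  by apply: flerM2l; [apply/idem_ge0/idemM|rewrite rleD2r].
have h2 : w * y <= w * z.
  have e' x : w * x = q * r * (p * x) by rewrite /w; ring.
  by rewrite !e'; apply: flerM2l => //; apply/idem_ge0/idemM.
have h3 : w * z <= w * (K t + K (e / 2)).
  have -> : w * (K t + K (e / 2)) = p * q * (r * K (e/2) + r * K t) by rewrite /w; ring.
  have -> : w * z = p * q * (r * (z - K t) + r * K t) by rewrite /w; ring.
  by apply: flerM2l; [apply/idem_ge0/idemM|rewrite rleD2r].
have := le_trans h1 (le_trans h2 h3); rewrite ![w * _]mulrC -rmorphB -rmorphD => h.
have := rleD h (lexx (K (e / 2) * w)).
by rewrite -!mulrDl -!rmorphD subrK -addrA -splitr.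
Qed.

Hypothesis DC : dedekind_complete A.

(** The value is the supremum of the constants below [y] on some member of [U]. The event that [y]
    exceeds it by [e] is not in [U], so its complement is. *)
Lemma uval_exists p y c : U p -> bnd p y c -> exists t, Val y t.
Proof.
move=> Up [b1 b2].
pose S := [set t : R | exists2 q, U q & q * K t <= q * y].
have Sc : ubound S c.
  move=> t [q Uq qt]; apply: (nzidem_const_lt (ultra_nz (ultraM uU Up Uq))).
  have ip := ultra_idem uU Up; have iq := ultra_idem uU Uq.
  rewrite ![K _ * _]mulrC; apply: (@le_trans _ _ (p * q * y)).
    by rewrite -!mulrA; apply: flerM2l => //; apply: idem_ge0.
  by rewrite ![p * q]mulrC -!mulrA; apply: flerM2l => //; apply: idem_ge0.
have S0 : S (- c) by exists p => //; rewrite rmorphN mulrN.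
have hS : has_sup S by split; [exists (- c)|exists c].
exists (sup S) => e e0.
have [t [q Uq qt] te] := sup_adherent e0 hS.
have [z [iz z1 z2]] := spectral DC (y - K (sup S + e)).
have Uz : U (1 - z).
  case: (ultraC uU iz) => // Uz; exfalso.
  have : S (sup S + e) by exists z => //; rewrite -rsub_ge0 -mulrBr.
  by move/(ub_le_sup (proj2 hS)); rewrite gerDl leNgt e0.
exists (q * (1 - z)); first exact: (ultraM uU).
have iq := ultra_idem uU Uq; have iz' := ultra_idem uU Uz.
split.
  rewrite -!mulrA; apply: flerM2l; first exact: idem_ge0.
  rewrite -rsub_ge0 -roppr_le0; move: z2; rewrite rmorphD.
  by congr (_ <= _); ring.
rewrite -rsub_ge0.
have -> : q * (1 - z) * (y - K (sup S)) - - (q * (1 - z) * K e) =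
  (1 - z) * (q * y - q * K t) + (q * (1 - z)) * K (t - (sup S - e)) by ring.
apply: raddr_ge0; apply: fmulr_ge0.
- exact: idem_ge0.
- by rewrite rsub_ge0.
- by apply/idem_ge0/idemM.
by apply: fconst_ge0; rewrite subr_ge0 ltW.
Qed.

Lemma uval_idem q : idem q -> Val q 1 \/ Val q 0.
Proof.
move=> iq; case: (ultraC uU iq) => Uq; [left|right]; apply: (uval_local Uq).
  by rewrite iq rmorph1 mulr1.
by rewrite rmorph0 mulr0 mulrBl mul1r iq subrr.
Qed.

End Values.
End Ultrafilters.

(** * Order sums, the exponential and the Poisson elements *)

Section Series.
Variables (R : realType) (A : fAlgebraType R).
Implicit Types (x y z w p q r H : A) (c d e s t : R) (f : nat -> A) (B : set nat).
Local Notation K := (@fconst R A).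

(** Bounds on a fixed idempotent pass to order limits, as values do not: multiplication by [p]
    shrinks the sequence controlling convergence. *)
Lemma bnd_seq_cvg p (x : nat -> A) (l z : A) e N : idem p -> seq_cvg x l ->
  (forall n, (N <= n)%N -> bnd p (x n - z) e) -> bnd p (l - z) e.
Proof.
move=> ip xl xe.
have pl : seq_cvg (fun n => p * x n) (p * l).
  move: xl => [y [dy iy xy]]; exists y; split => // n.
  have := xy n; rewrite !rabs_leP -!mulrBr => /andP[h1 h2].
  have y0 : 0 <= y n by apply: rabs_le_ge0 (xy n).
  have py : p * y n <= y n by rewrite -{2}(mul1r (y n)) ![_ * y n]mulrC; apply: flerM2l => //; apply: idem_le1.
  rewrite -mulrN; apply/andP; split; apply: le_trans py; apply: flerM2l => //; exact: idem_ge0.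
split.
  rewrite mulrBr rle_subl; apply: (seq_cvg_le pl (N := N)) => n /xe[h _].
  by rewrite -rle_subl -mulrBr.
rewrite mulrBr rle_subr; apply: (seq_cvg_ge pl (N := N)) => n /xe[_ h].
by rewrite -rle_subr -mulrBr.
Qed.

Lemma bndX p x e k : idem p -> bnd p x e -> bnd p (x ^+ k) (e ^+ k).
Proof.
move=> ip h; elim: k => [|k IH].
  by rewrite !expr0 -(rmorph1 K) -{2}(@normr1 R); apply: bnd_const.
by rewrite !exprS; apply: bndM.
Qed.

Lemma bnd_constM p c x e : idem p -> 0 <= c -> bnd p x e -> bnd p (K c * x) (c * e).
Proof. by move=> ip c0; apply: bndM => //; rewrite -{2}(ger0_norm c0); apply: bnd_const. Qed.

Lemma partial_sum_bnd p f (a : nat -> R) B M N : idem p ->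
  (forall k, 0 <= a k) -> (forall k, bnd p (f k) (a k)) -> (M <= N)%N ->
  bnd p (partial_sum B f N - partial_sum B f M)
        (\sum_(0 <= k < N) a k - \sum_(0 <= k < M) a k).
Proof.
move=> ip a0 fa; elim: N => [|N IH].
  by rewrite leqn0 => /eqP ->; rewrite !subrr; apply: bnd0.
rewrite leq_eqVlt => /predU1P[->|/IH h]; first by rewrite !subrr; apply: bnd0.
rewrite partial_sumS big_nat_recr//= addrAC [X in bnd _ _ X]addrAC; apply: bndD => //.
by case: ifP => _ //; apply: bnd0.
Qed.

Lemma order_sums_bnd p f (a : nat -> R) c B L N : idem p ->
  (forall k, 0 <= a k) -> (forall k, bnd p (f k) (a k)) ->
  (forall n, \sum_(0 <= k < n) a k <= c) -> order_sums B f L ->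
  bnd p (L - partial_sum B f N) (c - \sum_(0 <= k < N) a k).
Proof.
move=> ip a0 fa ac fL; apply: (bnd_seq_cvg ip fL (N := N)) => n Nn.
apply: bnd_le (partial_sum_bnd B ip a0 fa Nn) => //.
by rewrite lerD2r.
Qed.

Section Val.
Variables (U : set A) (uU : ultra U).

Lemma uval_bnd p x e t : U p -> bnd p x e -> uval U x t -> `|t| <= e.
Proof.
move=> Up [h1 h2] xt; rewrite ler_norml; apply/andP; split.
  apply: (uval_le uU Up (y := K (- e)) _ (uval_const uU _) xt).
  by rewrite rmorphN mulrN.
exact: (uval_le uU Up h1 xt (uval_const uU _)).
Qed.

Lemma uvalX x t k : uval U x t -> uval U (x ^+ k) (t ^+ k).
Proof.
move=> xt; elim: k => [|k IH]; first by rewrite !expr0; apply: uval1.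
by rewrite !exprS; apply: uvalM.
Qed.

Lemma uval_partial_sum B f (v : nat -> R) N : (forall k, uval U (f k) (v k)) ->
  uval U (partial_sum B f N) (\sum_(0 <= k < N | k \in B) v k).
Proof.
move=> fv; elim: N => [|N IH]; first by rewrite partial_sum0 big_geq//; apply: uval0.
rewrite partial_sumS big_mkcond big_nat_recr//= -big_mkcond.
by apply: uvalD => //; case: ifP => _ //; apply: uval0.
Qed.

Lemma uval_partial_sumT f (v : nat -> R) N : (forall k, uval U (f k) (v k)) ->
  uval U (partial_sum setT f N) (\sum_(0 <= k < N) v k).
Proof.
move=> fv; have := uval_partial_sum setT N fv.
by congr uval; apply: eq_bigl => k; rewrite in_setT.
Qed.

(** A Weierstrass test: the majorant [a] on one member of [U] bounds the truncation error of the
    values. *)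
Lemma uval_order_sums p f (a v : nat -> R) c B L t : U p ->
  (forall k, 0 <= a k) -> (forall k, bnd p (f k) (a k)) ->
  (forall n, \sum_(0 <= k < n) a k <= c) -> order_sums B f L ->
  (forall k, uval U (f k) (v k)) -> uval U L t ->
  forall N, `|t - \sum_(0 <= k < N | k \in B) v k| <= c - \sum_(0 <= k < N) a k.
Proof.
move=> Up a0 fa ac fL fv Lt N.
have h := order_sums_bnd N (ultra_idem uU Up) a0 fa ac fL.
by apply: (uval_bnd Up h); apply: uvalB => //; apply: uval_partial_sum.
Qed.

End Val.

Hypotheses (DC : dedekind_complete A) (LC : laterally_complete A).

Lemma uval_order_sums_exists U p f (a : nat -> R) c B L : ultra U -> U p ->
  (forall k, 0 <= a k) -> (forall k, bnd p (f k) (a k)) ->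
  (forall n, \sum_(0 <= k < n) a k <= c) -> order_sums B f L ->
  exists t, uval U L t.
Proof.
move=> uU Up a0 fa ac fL.
have := order_sums_bnd 0 (ultra_idem uU Up) a0 fa ac fL.
by rewrite partial_sum0 subr0 => /(uval_exists uU DC Up).
Qed.

(** [P] marks the idempotents on which the needed values exist. An ultrafilter through a marked
    piece of a gap idempotent would give values violating [s <= t]. *)
Lemma uval_transfer (P : A -> Prop) x y :
  (forall p, nzidem p -> exists2 p', sub_nz p' p & P p') ->
  (forall U p, ultra U -> U p -> P p ->
    exists s t, [/\ uval U x s, uval U y t & s <= t]) -> x <= y.
Proof.
move=> hP h; apply: contrapT => /(not_le_idem DC)[p [e [np e0 he]]].
have [p' s Pp'] := hP _ np; have [U uU Up'] := ultra_exists (proj1 s).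
have [a [b [xa yb ab]]] := h U p' uU Up' Pp'.
have ed : e <= a - b.
  apply: (uval_le uU Up' (y := K e) (z := x - y) _ (uval_const uU e) (uvalB uU xa yb)).
  by apply: (sub_nz_le s); rewrite mulrC.
by have := lt_le_trans e0 ed; rewrite subr_gt0 ltNge ab.
Qed.

Lemma local_bnd H p : 0 <= H -> nzidem p ->
  exists2 p', sub_nz p' p & exists n : nat, bnd p' H n%:R.
Proof.
move=> H0 np; have [p' [n [s Hn]]] := local_bounded DC H np.
have ip' : idem p' by case: s => -[].
exists p' => //; exists n; split => //; apply: (@le_trans _ _ 0).
  by rewrite roppr_le0; apply: fmulr_ge0; [apply: idem_ge0|apply: fconst_ge0].
by apply: fmulr_ge0 => //; apply: idem_ge0.
Qed.

(** Glues local bounds into a global one: [M] is the supremum of the disjoint pieces on which [H] is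
    about [n], weighted by [a n]. *)
Lemma lateral_bound H (a : nat -> R) : 0 <= H -> (forall n, 0 <= a n) ->
  exists M, forall x,
    (forall p n, idem p -> bnd p H n%:R -> p * x <= p * K (a n)) -> x <= M.
Proof.
move=> H0 a0.
have /choice[c cP] (n : nat) : exists c : A, [/\ idem c, 0 <= c * (H - K n%:R) & (1 - c) * (H - K n%:R) <= 0].
  exact: spectral.
pose D := fix D n : A := if n is m.+1 then D m * c m else 1.
have ic n : idem (c n) by case: (cP n).
have iD n : idem (D n) by elim: n => [|n IH]; [apply: idem1|apply: idemM].
(* [d n] is an event on which [n - 1 <= H <= n]. *)
pose d n := D n * (1 - c n).
have id n : idem (d n) by apply/idemM/idemC.
have Dc m n : (m < n)%N -> D n * c m = D n.
  elim: n => // n IH; rewrite ltnS leq_eqVlt => /predU1P[->|/IH h] /=.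
    by rewrite -mulrA ic.
  by rewrite mulrAC h.
have dd m n : (m < n)%N -> d m * d n = 0.
  move=> mn; rewrite /d -(Dc _ _ mn).
  have -> : D m * (1 - c m) * (D n * c m * (1 - c n)) =
    D m * D n * (1 - c n) * (c m - c m * c m) by ring.
  by rewrite ic subrr mulr0.
have dH n : bnd (d n) H n%:R.
  split; last first.
    apply: (@le_trans _ _ 0); last by apply: fmulr_ge0 => //; apply: idem_ge0.
    by rewrite roppr_le0; apply: fmulr_ge0; [apply: idem_ge0|apply: fconst_ge0].
  rewrite /d -!mulrA; apply: flerM2l; first exact: idem_ge0.
  by case: (cP n) => _ _; rewrite mulrBr -roppr_ge0 opprB rsub_ge0.
(* If [p] missed every [d n], it would lie below every [c n], so that [H >= n] on [p] for all
   [n]. *)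
have cover p : nzidem p -> exists n, p * d n <> 0.
  move=> np; apply: contrapT => hn.
  have pd n : p * d n = 0 by apply: contrapT => h; apply: hn; exists n.
  have pD n : p * D n = p.
    elim: n => [|n IH] /=; first by rewrite mulr1.
    by have := pd n; rewrite /d mulrBr mulr1 mulrBr mulrA IH => /eqP; rewrite subr_eq0 => /eqP.
  have pc n : p * c n = p by rewrite -{1}(pD n) -mulrA -/(D n.+1) pD.
  have [p' [n [s Hn]]] := local_bounded DC H np.
  have : n.+1%:R <= n%:R :> R.
    apply: (nzidem_const_lt (proj1 s)); rewrite ![K _ * _]mulrC.
    apply: le_trans Hn; apply: (sub_nz_le s).
    rewrite -(pc n.+1) -!mulrA; apply: flerM2l; first by apply: idem_ge0; case: np.
    by case: (cP n.+1) => _ + _; rewrite mulrBr rsub_ge0.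
  by rewrite ler_nat ltnn.
have [M [ubM _]] : supremums (range (fun n => K (a n) * d n)) !=set0.
  apply: LC; first by exists (K (a 0%N) * d 0%N), 0%N.
  - by move=> _ [n _ <-]; apply: fmulr_ge0; [apply: fconst_ge0|apply: idem_ge0].
  move=> _ _ [m _ <-] [n _ <-] mn.
  have dis i k : rmeet (d i) (d k) = 0 -> rmeet (K (a i) * d i) (K (a k) * d k) = 0.
    move=> ik; rewrite ![K _ * _]mulrC; apply: fmul_disjoint; last exact: fconst_ge0.
    by rewrite rmeetC; apply: fmul_disjoint; [rewrite rmeetC|apply: fconst_ge0].
  apply: dis; rewrite -idem_mul_meet//.
  have [mn'|nm'|e] := ltngtP m n; [exact: dd|by rewrite mulrC dd|].
  by case: mn; rewrite e.
exists M => x hx; apply: (local_le DC) => p np.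
have [n pd] := cover _ np; exists (p * d n).
  by apply: sub_nz_mul => //; case: np.
have ip : idem p by case: np.
apply: (@le_trans _ _ (p * d n * K (a n))).
  by apply: hx; [apply: idemM|apply: bnd_sub].
have -> : p * d n * K (a n) = p * d n * (K (a n) * d n).
  by rewrite [K _ * d n]mulrC [RHS]mulrA -[in RHS](mulrA p) id.
by apply: flerM2l; [apply/idem_ge0/idemM|apply: ubM; exists n].
Qed.

(** * The exponential and Poisson series of a possibly unbounded element *)

Section Exponential.
Variable H : A.
Hypothesis H0 : 0 <= H.

Lemma fexpE x k : fexp x k = x ^+ k.
Proof. by elim: k => // k IH; rewrite exprS -IH. Qed.

Lemma fexpr_ge0 x k : 0 <= x -> 0 <= x ^+ k.
Proof.
move=> x0; elim: k => [|k IH]; first by rewrite expr0 fone_ge0.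
by rewrite exprS fmulr_ge0.
Qed.

Definition expterm k : A := ((k`!)%:R : R)^-1 *: H ^+ k.

Lemma expterm_ge0 k : 0 <= expterm k.
Proof. by apply: rsp_scale_ge0; [rewrite invr_ge0|apply: fexpr_ge0]. Qed.

Lemma expterm_bnd p (n : R) k : idem p -> bnd p H n -> bnd p (expterm k) (exp_coeff n k).
Proof.
move=> ip Hn; rewrite /expterm fscaleE /exp_coeff /= [X in bnd _ _ X]mulrC.
by apply: bnd_constM => //; [rewrite invr_ge0|apply: bndX].
Qed.

(** No single constant bounds these sums, but on an idempotent where [H <= n] the number [expR n%:R]
    does. *)
Lemma expterm_sum_bounded : exists M, forall N, partial_sum setT expterm N <= M.
Proof.
have [M hM] := @lateral_bound H (fun n => expR n%:R) H0 (fun n => expR_ge0 _).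
exists M => N; apply: hM => p n ip Hn.
have [h _] := @partial_sum_bnd p expterm (exp_coeff n%:R) setT 0 N ip
  (fun k => exp_coeff_pos k (ler0n _ n)) (fun k => expterm_bnd k ip Hn) (leq0n N).
rewrite partial_sum0 [\sum_(0 <= k < 0) _]big_geq// !subr0 in h.
apply: le_trans h _; apply: flerM2l; first exact: idem_ge0.
by apply/fconst_le/expsum_le.
Qed.

Lemma expterm_abs k : rabs (((k`!)%:R : R)^-1 *: (- H) ^+ k) <= expterm k.
Proof.
rewrite exprNn -signr_odd rabs_leP /expterm.
have h0 := expterm_ge0 k; rewrite /expterm in h0.
have h : forall b : A, 0 <= b -> - b <= b.
  by move=> b b0; apply: (@le_trans _ _ 0); rewrite ?roppr_le0.
case: (odd k); rewrite ?expr1 ?expr0 ?mulN1r ?mul1r ?scalerN ?opprK lexx /= ?andbT h//.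
Qed.

(** Ensures that [exp_neg H] is a genuine limit and not the default value of [order_sum]. *)
Lemma exp_neg_sums :
  order_sums setT (fun k => ((k`!)%:R : R)^-1 *: fexp (- H) k) (exp_neg H).
Proof.
apply: order_sumsP; have [M hM] := expterm_sum_bounded.
apply: (@order_sums_exists _ _ _ _ expterm M) => //; first exact: expterm_ge0.
by move=> k; rewrite fexpE; apply: expterm_abs.
Qed.

Lemma exp_neg_val U p (n : nat) lam : ultra U -> U p -> bnd p H n%:R -> uval U H lam ->
  uval U (exp_neg H) (expR (- lam)).
Proof.
move=> uU Up Hn Hl; have ip := ultra_idem uU Up.
have fb k : bnd p (((k`!)%:R : R)^-1 *: fexp (- H) k) (exp_coeff n%:R k).
  rewrite fexpE fscaleE /exp_coeff /= [X in bnd _ _ X]mulrC.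
  by apply: bnd_constM => //; [rewrite invr_ge0|apply/bndX/bndN].
have a0 k : 0 <= exp_coeff n%:R k :> R by apply: exp_coeff_pos.
have ac N : \sum_(0 <= k < N) exp_coeff n%:R k <= expR n%:R :> R by apply: expsum_le.
have [t Lt] := uval_order_sums_exists uU Up a0 fb ac exp_neg_sums.
have fv k : uval U (((k`!)%:R : R)^-1 *: fexp (- H) k) (exp_coeff (- lam) k).
  rewrite fexpE fscaleE /exp_coeff /= [X in uval _ _ X]mulrC.
  by apply: uvalM => //; [apply: uval_const|apply/uvalX => //; apply: uvalN].
have key N := uval_order_sums uU Up a0 fb ac exp_neg_sums fv Lt N.
suff <- : t = expR (- lam) by [].
apply/eqP; rewrite -subr_eq0 -normr_le0; apply/ler_addgt0Pr => e e0.
have e2 : 0 < e / 2 by rewrite divr_gt0.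
have [N1 /(_ (maxn N1 _)) h1] := expsum_eps (- lam) e2.
have [N2 /(_ (maxn _ N2)) h2] := expsum_eps n%:R e2.
have := h1 N2 (leq_maxl _ _); have := h2 N1 (leq_maxr _ _); have := key (maxn N1 N2).
rewrite (eq_bigl xpredT); last by move=> k; rewrite in_setT.
rewrite -!/(expsum _ _) !ler_norml => /andP[? ?] /andP[? ?] /andP[? ?].
by apply/andP; split; lra.
Qed.

(** The alternating series does not show its sign; the bounds are transferred from [expR (- lam)]
    with [lam >= 0]. *)
Lemma exp_neg_bound : 0 <= exp_neg H /\ exp_neg H <= 1.
Proof.
have v U p n : ultra U -> U p -> bnd p H n%:R ->
    exists2 lam, 0 <= lam & uval U (exp_neg H) (expR (- lam)).
  move=> uU Up Hn; have [lam Hl] := uval_exists uU DC Up Hn.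
  exists lam; last exact: exp_neg_val uU Up Hn Hl.
  apply: (uval_le uU (ultra1 uU) _ (uval0 uU) Hl); rewrite mulr0 mul1r; exact: H0.
split; apply: (uval_transfer (fun p => local_bnd H0)) => U p uU Up [n Hn];
  have [lam l0 hv] := v U p n uU Up Hn.
  exists 0, (expR (- lam)); split => //; [exact: uval0|exact: expR_ge0].
exists (expR (- lam)), 1; split => //; first exact: uval1.
by rewrite -expR0 ler_expR oppr_le0.
Qed.

Lemma Po1E k : Po1 k H = expterm k * exp_neg H.
Proof. by rewrite /Po1 fexpE fmulE fscalerAl. Qed.

Lemma Po_sums B : order_sums B (fun k => Po1 k H) (Po B H).
Proof.
have [e0 e1] := exp_neg_bound.
apply: order_sumsP; have [M hM] := expterm_sum_bounded.
apply: (@order_sums_exists _ _ _ _ expterm M) => //; first exact: expterm_ge0.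
move=> k; rewrite Po1E.
have h0 : 0 <= expterm k * exp_neg H by apply: fmulr_ge0 => //; apply: expterm_ge0.
have h1 : expterm k * exp_neg H <= expterm k.
  by rewrite -[leRHS]mulr1; apply: flerM2l => //; apply: expterm_ge0.
rewrite rabs_leP h1 /=; apply: (@le_trans _ _ 0); rewrite ?roppr_le0//; exact: expterm_ge0.
Qed.

(** The value is described only by its distance to finite Poisson sums; the error is a tail of the
    exponential series at [n] and does not depend on [B]. *)
Lemma Po_val U p (n : nat) lam B : ultra U -> U p -> bnd p H n%:R -> uval U H lam ->
  exists2 v, uval U (Po B H) v &
    forall N, `|v - \sum_(0 <= k < N | k \in B) pois lam k| <= expR n%:R - expsum n%:R N.
Proof.
move=> uU Up Hn Hl; have ip := ultra_idem uU Up; have [e0 e1] := exp_neg_bound.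
have eb : bnd p (exp_neg H) 1.
  rewrite /bnd rmorph1 mulr1; split.
    by rewrite -[leRHS]mulr1; apply: flerM2l => //; apply: idem_ge0.
  apply: (@le_trans _ _ 0); first by rewrite roppr_le0 idem_ge0.
  by apply: fmulr_ge0 => //; apply: idem_ge0.
have a0 k : 0 <= exp_coeff n%:R k :> R by apply: exp_coeff_pos.
have fb k : bnd p (Po1 k H) (exp_coeff n%:R k).
  by rewrite Po1E -[exp_coeff _ _]mulr1; apply: bndM => //; apply: expterm_bnd.
have ac N : \sum_(0 <= k < N) exp_coeff n%:R k <= expR n%:R :> R by apply: expsum_le.
have [t Lt] := uval_order_sums_exists uU Up a0 fb ac (Po_sums B).
exists t => //.
have fv k : uval U (Po1 k H) (pois lam k).
  rewrite Po1E; apply: uvalM => //; last exact: exp_neg_val uU Up Hn Hl.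
  rewrite /expterm fscaleE /exp_coeff /= [X in uval _ _ X]mulrC.
  by apply: uvalM => //; [apply: uval_const|apply: uvalX].
by move=> N; have := uval_order_sums uU Up a0 fb ac (Po_sums B) fv Lt N.
Qed.

End Exponential.
End Series.

(** * Universal completions and naturally valued elements *)

Section Embedding.
Variables (R : realType) (E Eu : rieszSpaceType R) (j : {linear E -> Eu}).
Hypothesis UC : universal_completion j.
Implicit Types (x y z l : E) (f g : Eu).

Lemma uc_le x y : (j x <= j y) = (x <= y).
Proof.
have me (F : rieszSpaceType R) (a b : F) : (a <= b) <-> rmeet a b = a.
  split=> [ab|<-]; last exact: rmeet_ler.
  by apply/le_anti; rewrite rmeet_lel rmeet_ge.
apply/idP/idP => /me h; apply/me.
  by apply: (uc_inj UC); rewrite (uc_meet UC).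
by rewrite -(uc_meet UC) h.
Qed.

Lemma uc_abs x : j (rabs x) = rabs (j x).
Proof. by rewrite /rabs (uc_join UC) raddfN. Qed.

(** A lower bound with nonzero positive part would, by density, dominate [j x] for some [x > 0],
    making [x] a lower bound in [E]. *)
Lemma uc_inf0 (y : nat -> E) :
  infimums (range y) 0 -> infimums (range (fun n => j (y n))) 0.
Proof.
move=> [y0 y1]; have {}y0 n : 0 <= y n by apply: y0; exists n.
split; first by move=> _ [n _ <-]; rewrite -(raddf0 j) uc_le.
move=> b lb; apply: contrapT => nb.
have bp : 0 < rpos b.
  rewrite lt_neqAle rpos_ge0 andbT; apply/eqP => e; apply: nb.
  by rewrite e; apply: rjoin_gel.
have [x [x0 xb]] := uc_dense UC bp.
have : x <= 0.
  apply: y1 => _ [n _ <-]; rewrite -uc_le; apply: (le_trans xb).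
  apply: rjoin_le; first by apply: lb; exists n.
  by rewrite -(raddf0 j) uc_le.
by rewrite (lt_geF x0).
Qed.

Lemma uc_seq_cvg (x : nat -> E) l : seq_cvg x l -> seq_cvg (fun n => j (x n)) (j l).
Proof.
move=> [y [dy iy xy]]; exists (fun n => j (y n)); split.
- by move=> m n /dy; rewrite uc_le.
- exact: uc_inf0.
- by move=> n; rewrite -raddfB -uc_abs uc_le.
Qed.

Lemma uc_partial_sum A (f : nat -> E) n :
  j (partial_sum A f n) = partial_sum A (fun k => j (f k)) n.
Proof. by rewrite /partial_sum raddf_sum. Qed.

Lemma uc_order_sums A (f : nat -> E) l :
  order_sums A f l -> order_sums A (fun k => j (f k)) (j l).
Proof.
move/uc_seq_cvg; congr order_cvg; apply/funext => n; exact: uc_partial_sum.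
Qed.

(** The preimage is the supremum in [E] of the elements mapped below [f]; density leaves no room
    between its image and [f]. *)
Lemma uc_ideal f x : dedekind_complete E -> 0 <= f -> f <= j x -> exists z, j z = f.
Proof.
move=> EC f0 fx.
have [] := EC [set y | j y <= f]; first by [].
- by exists 0; rewrite /= raddf0.
- by exists x; split => // y yf; rewrite -uc_le; apply: le_trans fx.
move=> z [_ ub lub]; exists z.
have lt0 (g : Eu) : 0 <= g -> (forall y, 0 < y -> ~ j y <= g) -> g = 0.
  move=> g0 h; apply: contrapT => gn0.
  have : 0 < g by rewrite lt_neqAle g0 andbT; apply/eqP => e; apply: gn0.
  by move/(uc_dense UC) => [y [y0 yg]]; apply: (h y).
have zf : j z <= f.
  have g0 : rpos (j z - f) = 0.
    apply: lt0; first exact: rpos_ge0.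
    move=> y y0 yg; have : z <= z - y.
      apply: lub => // w wf; rewrite -uc_le raddfB rle_subr.
      have wz : j w <= j z by rewrite uc_le; apply: ub.
      rewrite addrC -rle_subr; apply: (le_trans yg); apply: rjoin_le.
        exact: rlerB.
      by rewrite rsub_ge0.
    by rewrite -{1}(addr0 z) rleD2l roppr_ge0 (lt_geF y0).
  by rewrite -rsub_ge0 -roppr_le0 opprB -g0; apply: rjoin_gel.
apply/esym/eqP; rewrite -subr_eq0; apply/eqP; apply: lt0; first by rewrite rsub_ge0.
move=> y y0; rewrite rle_subr addrC -raddfD => h.
by have := ub _ h; rewrite -{2}(addr0 z) rleD2l (lt_geF y0).
Qed.

End Embedding.

(** * Elements with natural values *)

Section LocallyNatural.
Variables (R : realType) (A : fAlgebraType R).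
Hypothesis DC : dedekind_complete A.
Implicit Types (x y z w p q s : A).
Local Notation K := (@fconst R A).

(** Radius 0 encodes equality on [p], so that [bnd_seq_cvg] also carries equalities to order
    limits. *)
Lemma bnd_zero_eq p x y : bnd p (x - y) 0 -> p * x = p * y.
Proof.
rewrite /bnd rmorph0 mulr0 oppr0 => h; apply/eqP; rewrite -subr_eq0 -mulrBr.
by apply/eqP/le_anti/andP.
Qed.

Lemma eq_bnd_zero p x y : p * x = p * y -> bnd p (x - y) 0.
Proof. by move=> h; rewrite /bnd rmorph0 mulr0 oppr0 mulrBr h subrr. Qed.

Lemma mul_partial_sum p (f : nat -> A) B n :
  p * partial_sum B f n = partial_sum B (fun k => p * f k) n.
Proof. by rewrite /partial_sum mulr_sumr. Qed.

Lemma partial_sum_single B (f : nat -> A) k n : (forall l, l <> k -> f l = 0) ->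
  partial_sum B f n = if (k < n)%N && (k \in B) then f k else 0.
Proof.
move=> f0; elim: n => [|n IH]; first by rewrite partial_sum0.
rewrite partial_sumS IH [(k < n.+1)%N]ltnS [(k <= n)%N]leq_eqVlt; have [->|nk] := eqVneq k n.
  by rewrite ltnn /= add0r.
by rewrite /= (f0 n) ?if_same ?addr0// => e; rewrite e eqxx in nk.
Qed.

Lemma disjoint_order_sums (r : nat -> A) (a : nat -> R) B L k :
  (forall k, idem (r k)) -> (forall k l, k <> l -> r k * r l = 0) ->
  order_sums B (fun k => K (a k) * r k) L ->
  r k * L = r k * K (if k \in B then a k else 0).
Proof.
move=> ir rr hL; apply: bnd_zero_eq; apply: (bnd_seq_cvg (ir k) hL (N := k.+1)) => n kn.
apply: eq_bnd_zero; rewrite mul_partial_sum (@partial_sum_single _ _ k).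
  rewrite kn /=; case: ifP => _; last by rewrite rmorph0 mulr0.
  by rewrite mulrCA ir mulrC.
by move=> l lk; rewrite mulrCA rr ?mulr0// => /esym.
Qed.

Lemma order_sums_cover (r : nat -> A) p : order_sums setT r 1 -> nzidem p ->
  exists k, p * r k <> 0.
Proof.
move=> h [ip np]; apply: contrapT => hn.
have pr k : p * r k = 0 by apply: contrapT => pk; apply: hn; exists k.
apply: np; rewrite -[p]mulr1 -[RHS](mulr0 p); apply: bnd_zero_eq.
apply: (bnd_seq_cvg ip h (N := 0)) => n _; apply: eq_bnd_zero.
by rewrite mulr0 mul_partial_sum /partial_sum big1.
Qed.

(** Stated by density because infinitely many values may occur. *)
Definition locally_nat s := forall p, nzidem p ->
  exists2 p', sub_nz p' p & exists k : nat, p' * s = p' * K k%:R.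

Lemma idem_locally_nat q : idem q -> locally_nat q.
Proof.
move=> iq p [ip p0]; have [e|n] := pselect (p * q = 0).
  by exists p; [|exists 0%N; rewrite rmorph0 mulr0].
exists (p * q); first exact: sub_nz_mul.
by exists 1%N; rewrite rmorph1 mulr1 -mulrA iq.
Qed.

Lemma locally_natD s t : locally_nat s -> locally_nat t -> locally_nat (s + t).
Proof.
move=> hs ht p np; have [p1 s1 [k hk]] := hs _ np.
have [p2 s2 [l hl]] := ht _ (proj1 s1); exists p2; first exact: sub_nz_trans s1.
by exists (k + l)%N; rewrite natrD rmorphD !mulrDr hl (sub_nz_eq s2 hk).
Qed.

Lemma partial_sum_locally_nat (q : nat -> A) n : (forall i, idem (q i)) ->
  locally_nat (partial_sum setT q n).
Proof.
move=> iq; elim: n => [|n IH].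
  rewrite partial_sum0 => p np; exists p; first exact: sub_nz_refl.
  by exists 0%N; rewrite rmorph0.
rewrite partial_sumS in_setT; apply: locally_natD => //; exact: idem_locally_nat.
Qed.

(** On a piece where [s <= N], take the largest natural [k] that some [x n] reaches on a smaller
    piece [p']. By maximality no [x m] exceeds [k] anywhere on [p'], so [s] equals [k] there. *)
Lemma cvg_locally_nat (x : nat -> A) s : nondecr x -> seq_cvg x s ->
  (forall n, 0 <= x n) -> (forall n, locally_nat (x n)) -> locally_nat s.
Proof.
move=> xS xs x0 nx p np.
have [p1 [N [s1 hN]]] := local_bounded DC s np.
pose good k := `[< exists n p', sub_nz p' p1 /\ p' * K k%:R <= p' * x n >].
have goodP k n p' : sub_nz p' p1 -> p' * K k%:R <= p' * x n -> good k.
  by move=> h1 h2; apply/asboolP; exists n, p'.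
have ge0 p' : nzidem p' -> 0 <= p' by case=> /idem_ge0.
have g0 : exists k, good k.
  exists 0%N; apply: (@goodP 0%N 0%N p1); first by apply: sub_nz_refl; case: s1.
  by rewrite rmorph0; apply: flerM2l => //; apply: ge0; case: s1.
have gN k : good k -> (k <= N)%N.
  move=> /asboolP[n [p' [s' h]]]; rewrite -(ler_nat R).
  apply: (nzidem_const_lt (proj1 s')); rewrite ![K _ * _]mulrC.
  apply: (le_trans h); apply: (@le_trans _ _ (p' * s)).
    by apply: flerM2l; [apply: ge0; case: s'|apply: seq_cvg_ub].
  exact: (sub_nz_le s' hN).
have [k /asboolP[n [p' [s' h]]] kmax] := ex_maxnP g0 gN.
have np' := proj1 s'.
exists p'; first exact: sub_nz_trans s' s1.
exists k; apply/le_anti/andP; split; last first.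
  by apply: (le_trans h); apply: flerM2l; [apply: ge0|apply: seq_cvg_ub].
have key m : p' * x m <= p' * K k%:R.
  apply: (local_le DC) => r nr; have [e|ne] := pselect (r * p' = 0).
    by exists r; [apply: sub_nz_refl|rewrite !mulrA e !mul0r].
  have s2 : sub_nz (r * p') p' by apply: sub_nz_mulr => //; [case: nr|case: np'].
  have s3 : sub_nz (r * p') r by apply: sub_nz_mul => //; [case: nr|case: np'].
  have [r' s4 [k' hk']] := nx m _ (proj1 s2).
  exists r'; first exact: sub_nz_trans s4 s3.
  have [_ e'] := sub_nz_trans s4 s2.
  rewrite !mulrA e' hk'; apply: flerM2l; first by apply: ge0; case: s4.
  apply/fconst_le; rewrite ler_nat; apply: kmax.
  apply: (@goodP k' m r'); last by rewrite hk'.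
  exact: sub_nz_trans s4 (sub_nz_trans s2 s').
have ip' : idem p' by case: np'.
(* A global upper bound of the sequence that agrees with [k] on [p'], so it passes to the limit
   before multiplying by [p']. *)
have : s <= (1 - p') * s + p' * K k%:R.
  apply: (seq_cvg_le xs (N := 0)) => m _.
  have -> : x m = (1 - p') * x m + p' * x m by ring.
  apply: rleD => //; apply: flerM2l; first exact/idem_ge0/idemC.
  exact: seq_cvg_ub.
move/(flerM2l (idem_ge0 ip')); congr (_ <= _).
by rewrite mulrDr !mulrA mulrBr mulr1 ip' subrr mul0r add0r.
Qed.

(** Cutting at [n - 1/2] keeps natural values away from the threshold, where [spectral] leaves the
    event undetermined. *)
Lemma locally_nat_decomposition s : locally_nat s ->
  exists r : nat -> A, forall p, nzidem p -> exists2 p', sub_nz p' p &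
    exists k : nat, p' * s = p' * K k%:R /\ forall l, p' * r l = if l == k then p' else 0.
Proof.
move=> ns.
(* [c n] is the event [s >= n]. *)
have /choice[c cP] (n : nat) : exists c : A, [/\ idem c, 0 <= c * (s - K (n%:R - 2^-1)) &
    (1 - c) * (s - K (n%:R - 2^-1)) <= 0] by apply: spectral.
exists (fun k => c k * (1 - c k.+1)) => p np.
have [p' s' [k hk]] := ns _ np; exists p' => //; exists k; split => //.
have ip' : idem p' by case: s' => -[].
have ge0 := idem_ge0 ip'.
have pc l : p' * c l = if (l <= k)%N then p' else 0.
  have [ic h1 h2] := cP l; have ic' := idemC ic.
  case: leqP => lk.
    apply/esym/eqP; rewrite -subr_eq0 -{1}(mulr1 p') -mulrBr; apply/eqP/le_anti.
    rewrite fmulr_ge0 ?idem_ge0// andbT.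
    apply: (@fconst_mul_le0 _ _ (k%:R - (l%:R - 2^-1))).
      have : l%:R <= k%:R :> R by rewrite ler_nat.
      by lra.
    rewrite mulrC rmorphB -mulrA mulrCA mulrBr -hk -mulrBr mulrCA.
    by rewrite -roppr_ge0 -mulrN; apply: fmulr_ge0; rewrite ?roppr_ge0.
  apply/le_anti; rewrite [X in _ && X]fmulr_ge0 ?idem_ge0// andbT.
  apply: (@fconst_mul_le0 _ _ ((l%:R - 2^-1) - k%:R)).
    have : k.+1%:R <= l%:R :> R by rewrite ler_nat.
    by rewrite -natr1; lra.
  rewrite mulrC rmorphB -mulrA mulrCA mulrBr -hk -mulrBr mulrCA.
  by rewrite -roppr_ge0 -!mulrN opprB; apply: fmulr_ge0.
move=> l; rewrite mulrBr mulr1 mulrBr pc mulrA pc.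
case: (ltngtP l k) => lk.
- by rewrite pc lk subrr.
- by rewrite mul0r subrr.
- by rewrite pc lk ltnn subr0.
Qed.

End LocallyNatural.

(** * Poisson approximation *)

Section PoissonBinomialElement.
Variables (R : realType) (A : fAlgebraType R).
Hypothesis DC : dedekind_complete A.
Local Notation K := (@fconst R A).

(** One polynomial with two uses: at the idempotents [j (q i)] it is the event itself, at
    [j (T (q i))] its conditional probability. *)
Fixpoint fpbin (x : nat -> A) n (a : pred nat) : A :=
  if n is m.+1 then x m * fpbin x m (fun k => a k.+1) + (1 - x m) * fpbin x m a
  else K (a 0%N)%:R.

(** Reversed because [fpbin] splits off the last index while [pbin] splits off the head. *)
Fixpoint rev_prefix (v : nat -> R) n : seq R :=
  if n is m.+1 then v m :: rev_prefix v m else [::].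

Lemma size_rev_prefix v n : size (rev_prefix v n) = n.
Proof. by elim: n => //= n ->. Qed.

Lemma mem_rev_prefix v n h : h \in rev_prefix v n -> exists i, h = v i.
Proof. by elim: n => //= n IH; rewrite inE => /predU1P[->|/IH//]; exists n. Qed.

Lemma sum_rev_prefix v n : \sum_(h <- rev_prefix v n) h = \sum_(0 <= i < n) v i.
Proof.
elim: n => [|n IH]; first by rewrite big_nil big_geq.
by rewrite big_cons IH big_nat_recr//= addrC.
Qed.

Lemma uval_fpbin U x v n a : ultra U -> (forall i, uval U (x i) (v i)) ->
  uval U (fpbin x n a) (pbin (rev_prefix v n) (fun k => (a k)%:R)).
Proof.
move=> uU xv; elim: n a => [|n IH] a /=; first exact: uval_const.
apply: (uvalD uU); apply: (uvalM uU); [exact: xv|exact: IH| |exact: IH].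
by apply: (uvalB uU) => //; apply: uval1.
Qed.

Lemma idem_fpbin x n a : (forall i, idem (x i)) -> idem (fpbin x n a).
Proof.
move=> ix; elim: n a => [|n IH] a /=.
  by case: (a 0); rewrite ?rmorph1 ?rmorph0 /idem ?mulr1 ?mulr0.
have h1 := IH (fun k => a k.+1); have h2 := IH a; have h3 := ix n.
set X := fpbin x n _ in h1 *; set Y := fpbin x n _ in h2 *; rewrite /idem.
have -> : (x n * X + (1 - x n) * Y) * (x n * X + (1 - x n) * Y) =
  x n * x n * (X * X) + (1 - x n) * (1 - x n) * (Y * Y) + (x n - x n * x n) * (X * Y *+ 2) by ring.
by rewrite h1 h2 h3 (idemC h3) subrr mul0r addr0.
Qed.

Lemma pbin_nat (b : nat -> nat) n (f : nat -> R) : (forall i, b i = 0 \/ b i = 1)%N ->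
  pbin (rev_prefix (fun i => (b i)%:R) n) f = f (\sum_(0 <= i < n) b i)%N.
Proof.
move=> b01; elim: n f => [|n IH] f /=; first by rewrite big_geq.
rewrite !IH big_nat_recr//=; case: (b01 n) => ->.
  by rewrite mul0r add0r subr0 mul1r addn0.
by rewrite subrr mul0r addr0 mul1r addn1.
Qed.

(** With [a] constantly 1 it gives the sum [u] of a decomposition, with [a k = k] the sum [s]. *)
Lemma local_sup (r : nat -> A) (a : nat -> R) L : (forall k, 0 <= a k) ->
  (forall p, nzidem p -> exists2 p', sub_nz p' p &
    exists k : nat, p' * L = p' * K (a k) /\ forall l, p' * r l = if l == k then p' else 0) ->
  supremums (range (partial_sum setT (fun k => K (a k) * r k))) L.
Proof.
move=> a0 hr.
have ps p' k n : (forall l, p' * r l = if l == k then p' else 0) ->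
    p' * partial_sum setT (fun k => K (a k) * r k) n = if (k < n)%N then p' * K (a k) else 0.
  move=> h; rewrite mul_partial_sum (@partial_sum_single _ _ _ _ k) => [|l lk].
    by rewrite in_setT andbT mulrCA h eqxx mulrC.
  by rewrite mulrCA h; move/eqP/negbTE: lk => ->; rewrite mulr0.
split=> [_ [n _ <-]|b ub].
  apply: (local_le DC) => p /hr[p' s [k [e h]]]; exists p' => //.
  rewrite (ps _ _ _ h) e; case: ifP => // _; apply: fmulr_ge0.
    by apply: idem_ge0; case: s => -[].
  exact: fconst_ge0.
apply: (local_le DC) => p /hr[p' s [k [e h]]]; exists p' => //.
rewrite e; have <- : p' * partial_sum setT (fun k => K (a k) * r k) k.+1 = p' * K (a k).
  by rewrite (ps _ _ _ h) ltnSn.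
by apply: flerM2l; [apply: idem_ge0; case: s => -[]|apply: ub; exists k.+1].
Qed.

End PoissonBinomialElement.

(** * The approximation in the Riesz space *)

Section PoissonApproximation.
Variables (R : realType) (E : rieszSpaceType R) (Eu : fAlgebraType R).
Variables (j : {linear E -> Eu}) (u : E) (T : {linear E -> E}).
Hypotheses (E_complete : dedekind_complete E) (UC : universal_completion j)
  (ju : j u = fone) (T_ce : conditional_expectation T) (Tu : T u = u).
Variables (q : nat -> E) (s : E).
Hypotheses (q_comp : forall i, is_component u (q i))
  (q_indep : indep_component_family j T u q) (s_sum : order_sums setT q s).
Local Notation K := (@fconst R Eu).
Let DC := uc_dedekind UC.
Let LC := uc_lateral UC.

Lemma uc_component p : is_component u p <-> idem (j p).
Proof.
rewrite -component_idem /is_component -ju -raddfB -(uc_meet UC) (uc_le UC).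
have -> : (0 <= j p) = (0 <= p) by rewrite -(raddf0 j) (uc_le UC).
by split=> -[-> h]; split=> //; [rewrite h raddf0|apply: (uc_inj UC); rewrite h raddf0].
Qed.

Lemma jq_idem i : idem (j (q i)).
Proof. exact/uc_component. Qed.

Lemma q_ge0 i : 0 <= q i.
Proof. by case: (q_comp i) => /andP[]. Qed.

Lemma T_le x y : x <= y -> T x <= T y.
Proof.
by move=> xy; rewrite -rsub_ge0 -raddfB; apply: (ce_ge0 T_ce); rewrite rsub_ge0.
Qed.

Lemma T_abs x y : rabs x <= y -> rabs (T x) <= T y.
Proof.
by rewrite !rabs_leP -raddfN => /andP[h1 h2]; rewrite !T_le.
Qed.

Lemma directed_nat : directed (fun m n : nat => (m <= n)%N).
Proof.
split; [by exists 0%N|by []|by move=> i k l; apply: leq_trans|].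
by move=> i k; exists (maxn i k); rewrite leq_maxl leq_maxr.
Qed.

Lemma T_order_sums B f l : order_sums B f l -> order_sums B (fun k => T (f k)) (T l).
Proof.
move/(ce_order_continuous T_ce directed_nat); congr order_cvg.
by apply/funext => n; rewrite /= /partial_sum raddf_sum.
Qed.

Lemma s_locally_nat : locally_nat (j s).
Proof.
have jq0 k : 0 <= j (q k) by apply/idem_ge0/jq_idem.
apply: (@cvg_locally_nat _ _ DC (partial_sum setT (fun i => j (q i)))).
- exact: partial_sum_nondecr.
- exact: uc_order_sums.
- by move=> n; apply: rsum_ge0.
- by move=> n; apply: partial_sum_locally_nat; apply: jq_idem.
Qed.

Lemma uc_natmul k (x : E) : j (x *+ k) = K k%:R * j x.
Proof. by rewrite raddfMn -fscaleE scaler_nat. Qed.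

(** Makes the choice in [cond_prob] a true decomposition instead of the default zero sequence. *)
Lemma nat_decomposition_exists : exists r, nat_decomposition u s r.
Proof.
have [r hr] := locally_nat_decomposition DC s_locally_nat.
have ir k : idem (r k).
  apply: (local_eq DC) => p /hr[p' s' [l [_ h]]]; exists p' => //.
  by rewrite mulrA h; case: eqP => [e|_]; rewrite ?mul0r// e h eqxx.
have /choice[rE rEr] (k : nat) : exists z, j z = r k.
  apply: (uc_ideal UC (x := u) E_complete (idem_ge0 (ir k))).
  by rewrite ju; apply: idem_le1.
have cvg (a : nat -> R) (f : nat -> E) l : (forall k, 0 <= a k) ->
    (forall k, j (f k) = K (a k) * r k) -> (forall k, 0 <= f k) ->
    (forall p' k, nzidem p' -> p' * j s = p' * K k%:R -> p' * j l = p' * K (a k)) ->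
    order_sums setT f l.
  move=> a0 jf f0 hl; apply: sup_seq_cvg; first exact: partial_sum_nondecr.
  have [ub lub] : supremums (range (partial_sum setT (fun k => K (a k) * r k))) (j l).
    apply: local_sup => // p /hr[p' s' [k [e h]]]; exists p' => //; exists k; split => //.
    by apply: hl => //; case: s'.
  have js n : j (partial_sum setT f n) = partial_sum setT (fun k => K (a k) * r k) n.
    by rewrite uc_partial_sum; congr partial_sum; apply/funext.
  split=> [_ [n _ <-]|b hb]; first by rewrite -(uc_le UC) js; apply: ub; exists n.
  rewrite -(uc_le UC); apply: lub => _ [n _ <-]; rewrite -js (uc_le UC).
  by apply: hb; exists n.
have rE0 k : 0 <= rE k by rewrite -(uc_le UC) raddf0 rEr idem_ge0.
exists rE; split.
- by move=> k; apply/uc_component; rewrite rEr.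
- move=> k l kl; apply: (uc_inj UC); rewrite (uc_meet UC) !rEr raddf0 -idem_mul_meet//.
  apply: (local_eq DC) => p /hr[p' s' [m [_ h]]]; exists p' => //.
  rewrite mulrA h mulr0; case: eqP => [km|_]; last by rewrite mul0r.
  by rewrite h; case: eqP => // lm; case: kl; rewrite km.
- apply: (cvg (fun=> 1)) => // [k|p' k _ _]; first by rewrite rmorph1 mul1r.
  by rewrite ju rmorph1.
apply: (cvg (fun k => k%:R)) => // k; first by rewrite uc_natmul rEr.
exact: rmulrn_ge0.
Qed.

Section Decomposition.
Variables (r : nat -> E) (A : set nat).
Hypothesis r_dec : nat_decomposition u s r.

Lemma r_ge0 k : 0 <= r k.
Proof. by case: r_dec => /(_ k)[/andP[]]. Qed.

Lemma jr_idem k : idem (j (r k)).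
Proof. by apply/uc_component; case: r_dec. Qed.

Lemma jr_disjoint k l : k <> l -> j (r k) * j (r l) = 0.
Proof.
move=> kl; apply: disjoint_mul0; rewrite -(uc_meet UC).
by case: r_dec => _ /(_ _ _ kl) -> _ _; rewrite raddf0.
Qed.

Lemma event_exists : exists X, order_sums A r X.
Proof.
case: r_dec => _ _ ru _; apply: (nondecr_bounded_cvg (b := u) E_complete).
  by apply: partial_sum_nondecr; apply: r_ge0.
move=> n; apply: le_trans (partial_sum_le_setT _ _ r_ge0) _.
by apply: seq_cvg_ub ru; apply: partial_sum_nondecr; apply: r_ge0.
Qed.

Variable X : E.
Hypothesis X_sum : order_sums A r X.

Lemma jr_mul_X k : j (r k) * j X = j (r k) * K (k \in A)%:R.
Proof.
have h : order_sums A (fun k => K 1 * j (r k)) (j X).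
  have := uc_order_sums UC X_sum; congr order_sums.
  by apply/funext => i; rewrite rmorph1 mul1r.
rewrite (disjoint_order_sums k jr_idem jr_disjoint h).
by case: ifP.
Qed.

Lemma jr_mul_s k : j (r k) * j s = j (r k) * K k%:R.
Proof.
have h : order_sums setT (fun k => K k%:R * j (r k)) (j s).
  case: r_dec => _ _ _ /(uc_order_sums UC); congr order_sums.
  by apply/funext => i; rewrite uc_natmul.
by rewrite (disjoint_order_sums k jr_idem jr_disjoint h) in_setT.
Qed.

Lemma jr_cover p : nzidem p -> exists2 p', sub_nz p' p & exists k, p' * j (r k) = p'.
Proof.
move=> np; have h : order_sums setT (fun k => j (r k)) 1.
  by case: r_dec => _ _ /(uc_order_sums UC) + _; rewrite ju.
have [k pk] := order_sums_cover h np; have ip : idem p by case: np.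
exists (p * j (r k)); first exact: sub_nz_mul (jr_idem k) pk.
by exists k; rewrite -mulrA jr_idem.
Qed.

End Decomposition.

(** The event that the number of occurring [q i] with [i < n] satisfies [a]. Written with meets, it
    stays in [E] and in every closed Riesz subspace containing [u] and these [q i]. *)
Fixpoint event (n : nat) (a : pred nat) : E :=
  if n is m.+1 then rmeet (q m) (event m (fun k => a k.+1)) +
    (event m a - rmeet (q m) (event m a))
  else if a 0%N then u else 0.

Lemma uc_event n a : j (event n a) = fpbin (fun i => j (q i)) n a.
Proof.
elim: n a => [|n IH] a /=.
  by case: (a 0%N); rewrite ?ju ?rmorph1 ?rmorph0 ?raddf0.
rewrite raddfD raddfB /= !(uc_meet UC) !IH.
rewrite -!idem_mul_meet; try exact: jq_idem; try exact: idem_fpbin jq_idem.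
by rewrite mulrBl mul1r.
Qed.

Lemma event_idem n a : idem (j (event n a)).
Proof. by rewrite uc_event; apply/idem_fpbin/jq_idem. Qed.

Lemma event_mem n a (F : set E) : closed_riesz_subspace F -> F u ->
  (forall i, (i < n)%N -> F (q i)) -> F (event n a).
Proof.
move=> [[F0 FZ _ FI] _] Fu; elim: n a => [|n IH] a Fq /=; first by case: (a 0%N).
have Fn b : F (event n b) by apply: IH => i /ltnW; apply: Fq.
have FD x y : F x -> F y -> F (x + y) by move=> Fx Fy; rewrite -[x]scale1r; apply: FZ.
have FN x : F x -> F (- x).
  by move=> Fx; rewrite -scaleN1r -[_ *: _]addr0; apply: FZ.
apply: (FD); first by apply: (FI) => //; apply: Fq.
by apply: FD => //; apply/FN/FI => //; apply: Fq.
Qed.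

Lemma T_meet_event n a :
  j (T (rmeet (q n) (event n a))) = j (T (q n)) * j (T (event n a)).
Proof.
case: q_indep => hF hI.
have [] := hI [set i | i <> n] [set n] _ (event n a) (q n).
- by rewrite -subset0 => i [h1 h2]; apply: h1.
- move=> F [cF hF']; apply: event_mem => //.
    (* [u = T u] lies in the range of [T], hence in each generated subspace; the index [n.+1]
       supplies one even when [n = 0]. *)
    have n1 : n.+1 <> n by move/eqP; rewrite eqn_leq ltnn.
    by apply: hF'; exists n.+1 => // G [_]; apply; right; exists u.
  move=> i /[dup] ni; rewrite ltn_neqAle => /andP[/eqP ine _].
  by apply: hF'; exists i => // G [_]; apply; left.
- move=> F [_]; apply; exists n => // G [_]; apply; by left.
- exact/uc_component/event_idem.
- exact: q_comp.
move=> p [jp jTp]; rewrite mulrC -[RHS]jTp; congr (j (T _)).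
apply: (uc_inj UC); rewrite jp (uc_meet UC) rmeetC -idem_mul_meet//.
  exact: event_idem.
exact: jq_idem.
Qed.

Lemma T_event n a : j (T (event n a)) = fpbin (fun i => j (T (q i))) n a.
Proof.
elim: n a => [|n IH] a /=.
  by case: (a 0%N); rewrite ?Tu ?ju ?rmorph1 ?rmorph0 ?raddf0.
by rewrite !raddfD !raddfN /= !T_meet_event !IH mulrBl mul1r.
Qed.

(** Where [s] has value [k], the partial sum has a natural value at most [k]. If they agree so do
    the two indicators; otherwise the right side is at least 1. *)
Lemma event_approx (r : nat -> E) A X n : nat_decomposition u s r -> order_sums A r X ->
  rabs (X - event n (fun k => k \in A)) <= s - partial_sum setT q n.
Proof.
move=> rd hX; set a := fun k => k \in A.
have values U p : ultra U -> U p -> (exists k, p * j (r k) = p) ->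
    exists x y z, [/\ uval U (j X) x, uval U (j (event n a)) y,
      uval U (j s - j (partial_sum setT q n)) z & `|x - y| <= z].
  move=> uU Up [k pk].
  have loc y t : j (r k) * y = j (r k) * K t -> uval U y t.
    by move=> h; apply: (uval_local uU Up); rewrite -pk -!mulrA h.
  have /choice[b hb] i : exists b : nat, (b = 0 \/ b = 1)%N /\ uval U (j (q i)) b%:R.
    by case: (uval_idem uU (jq_idem i)) => h; [exists 1%N|exists 0%N]; split => //; [right|left].
  have b01 i := proj1 (hb i); have bv i := proj2 (hb i).
  have vs := loc _ _ (jr_mul_s rd k).
  have vn : uval U (j (partial_sum setT q n)) (\sum_(0 <= i < n) b i)%N%:R.
    by rewrite uc_partial_sum natr_sum; apply: uval_partial_sumT.
  have ve := uval_fpbin n a uU bv; rewrite -uc_event pbin_nat// in ve.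
  exists (a k)%:R, (a (\sum_(0 <= i < n) b i)%N)%:R, (k%:R - (\sum_(0 <= i < n) b i)%N%:R).
  split => //; first exact: loc (jr_mul_X rd hX k).
    exact: uvalB.
  have le : (\sum_(0 <= i < n) b i <= k)%N.
    rewrite -(ler_nat R); apply: (uval_le uU (ultra1 uU) _ vn vs).
    rewrite !mul1r (uc_le UC); apply: seq_cvg_ub s_sum.
    by apply: partial_sum_nondecr; apply: q_ge0.
  move: (\sum_(0 <= i < n) b i)%N le => N; rewrite leq_eqVlt => /predU1P[->|lt].
    by rewrite !subrr normr0.
  have : (N.+1%:R : R) <= k%:R by rewrite ler_nat.
  rewrite -natr1; have c01 (c : bool) : 0 <= (c%:R : R) <= 1 by rewrite ler0n lern1 leq_b1.
  have /andP[? ?] := c01 (a k); have /andP[? ?] := c01 (a N).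
  by move=> ?; rewrite ler_norml; apply/andP; split; lra.
rewrite -(uc_le UC) (uc_abs UC) raddfB raddfB rabs_leP; apply/andP; split.
  apply: (uval_transfer DC (jr_cover rd)) => U p uU Up /(values U p uU Up)[x [y [z [hx hy hz]]]].
  rewrite ler_norml => /andP[_ h]; exists (x - y), z; split => //; exact: uvalB.
apply: (uval_transfer DC (jr_cover rd)) => U p uU Up /(values U p uU Up)[x [y [z [hx hy hz]]]].
rewrite ler_norml lerNl => /andP[h _]; exists (- (x - y)), z; split => //.
by apply: uvalN => //; apply: uvalB.
Qed.

Lemma poisson_approx n A m : (forall i, T (q i) <= m) -> m <= u ->
  rabs (j (T (event n (fun k => k \in A))) - Po A (j (T s))) <=
    j m + (j (T s) - j (T (partial_sum setT q n))) *+ 2.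
Proof.
move=> hm mu; set a := fun k => k \in A.
have Tq0 i : 0 <= T (q i) by apply/(ce_ge0 T_ce)/q_ge0.
have m0 : 0 <= m by apply: le_trans (Tq0 0%N) (hm 0%N).
have sn : partial_sum setT q n <= s.
  by apply: seq_cvg_ub s_sum; apply: partial_sum_nondecr; apply: q_ge0.
have H0 : 0 <= j (T s).
  rewrite -(raddf0 j) (uc_le UC) -(raddf0 T); apply: T_le; apply: le_trans sn.
  by apply: rsum_ge0 => i _; apply: q_ge0.
have values U p : ultra U -> U p -> (exists N : nat, bnd p (j (T s)) N%:R) ->
    exists x y z, [/\ uval U (j (T (event n a))) x, uval U (Po A (j (T s))) y,
      uval U (j m + (j (T s) - j (T (partial_sum setT q n))) *+ 2) z & `|x - y| <= z].
  move=> uU Up [N HN].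
  have unit_val z : 0 <= z -> z <= u -> exists t, 0 <= t <= 1 /\ uval U (j z) t.
    move=> z0 zu.
    have jz0 : 0 <= j z by rewrite -(raddf0 j) (uc_le UC).
    have jz1 : j z <= 1 by rewrite -[1]ju (uc_le UC).
    have [|t zt] := @uval_exists _ _ _ uU DC 1 (j z) 1 (ultra1 uU).
      split; rewrite mul1r rmorph1 mul1r//; apply: le_trans jz0.
      by rewrite roppr_le0 fone_ge0.
    exists t; split => //; apply/andP; split.
      by apply: (uval_le uU (ultra1 uU) _ (uval0 uU) zt); rewrite !mul1r.
    by apply: (uval_le uU (ultra1 uU) _ zt (uval1 uU)); rewrite !mul1r.
  have /choice[v hv] i := unit_val _ (Tq0 i) (le_trans (hm i) mu).
  have v01 i := proj1 (hv i); have vv i := proj2 (hv i).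
  have [mv [/andP[mv0 _] hmv]] := unit_val _ m0 mu.
  have [lam hl] := uval_exists uU DC Up HN.
  have [y hy ytail] := Po_val DC LC H0 A uU Up HN hl.
  have vn : uval U (j (T (partial_sum setT q n))) (\sum_(0 <= i < n) v i).
    rewrite /partial_sum !raddf_sum -/(partial_sum setT (fun i => j (T (q i))) n).
    exact: uval_partial_sumT.
  have ve := uval_fpbin n a uU vv; rewrite -T_event in ve.
  have vm i : v i <= mv.
    by apply: (uval_le uU (ultra1 uU) _ (vv i) hmv); rewrite !mul1r (uc_le UC).
  have nl : \sum_(0 <= i < n) v i <= lam.
    apply: (uval_le uU (ultra1 uU) _ vn hl); rewrite !mul1r (uc_le UC); exact: T_le.
  set x := pbin _ _ in ve.
  exists x, y, (mv + (lam - \sum_(0 <= i < n) v i) *+ 2); split => //.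
    apply: uvalD => //; rewrite !mulr2n; apply: uvalD => //; exact: uvalB.
  apply/ler_addgt0Pr => e e0; have [N1 h1] := expsum_eps N%:R e0.
  (* [n.+2] leaves room for the [n] trials and the extra one of [pbin_poisson_shift]; [N1] makes the
     Poisson tail at most [e]. *)
  have := ytail (maxn N1 n.+2); have := h1 (maxn N1 n.+2) (leq_maxl _ _).
  have := @pbin_poisson_shift R (rev_prefix v n) mv a (maxn N1 n.+2) lam.
  rewrite size_rev_prefix leq_maxr sum_rev_prefix -/x => /(_ _ _ mv0 isT nl) H.
  have {H}: `|x - \sum_(0 <= k < maxn N1 n.+2 | a k) pois lam k| <=
      mv + (lam - \sum_(0 <= i < n) v i) *+ 2.
    by apply: H => h /mem_rev_prefix[i ->].
  move=> H1 H2 H3; have := ler_distD (\sum_(0 <= k < maxn N1 n.+2 | a k) pois lam k) x y.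
  move/le_trans; apply; apply: lerD => //; rewrite distrC; apply: (le_trans H3).
  by apply: le_trans H2; apply: ler_norm.
rewrite rabs_leP; apply/andP; split.
  apply: (uval_transfer DC (fun p => local_bnd DC H0)) => U p uU Up /(values U p uU Up)[x [y [z [hx hy hz]]]].
  rewrite ler_norml => /andP[_ h]; exists (x - y), z; split => //; exact: uvalB.
apply: (uval_transfer DC (fun p => local_bnd DC H0)) => U p uU Up /(values U p uU Up)[x [y [z [hx hy hz]]]].
rewrite ler_norml lerNl => /andP[h _]; exists (- (x - y)), z; split => //.
by apply: uvalN => //; apply: uvalB.
Qed.

Lemma poisson_bound A : rabs (j (cond_prob T u s A) - Po A (j (T s)))
    <= j (supremum 0 (range (fun i => T (q i)))).
Proof.
set m := supremum _ _.
have Tqu i : T (q i) <= u by rewrite -Tu; apply: T_le; case: (q_comp i) => /andP[].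
have [ubm lubm] : supremums (range (fun i => T (q i))) m.
  have h := nondecr_bounded_sup E_complete Tqu.
  rewrite /m /supremum ifF; first exact: xgetPex.
  by apply/negbTE/set0P; exists (T (q 0%N)), 0%N.
have hm i : T (q i) <= m by apply: ubm; exists i.
have mu : m <= u by apply: lubm => _ [i _ <-].
have rd : nat_decomposition u s (xget (fun=> 0) [set r : nat -> E | nat_decomposition u s r]).
  exact: xgetPex nat_decomposition_exists.
rewrite /cond_prob; set r := xget _ _ in rd *.
have [X hX] := event_exists A rd.
rewrite (order_sum_eq (T_order_sums hX)).
set z := rabs _; pose a := fun k => k \in A.
(* One copy of [H - H_n] comes from [event_approx] under [T], two from [poisson_approx]. *)
have key n : z - j m <= (j (T s) - j (T (partial_sum setT q n))) *+ 3.
  have h1 : rabs (j (T X) - j (T (event n a))) <= j (T s) - j (T (partial_sum setT q n)).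
    rewrite -!raddfB -(uc_abs UC) (uc_le UC); apply: T_abs; exact: event_approx rd hX.
  have h2 := poisson_approx n A hm mu; rewrite -/a in h2.
  rewrite rle_subl; set D := j (T s) - j (T (partial_sum setT q n)) in h1 h2 *.
  have -> : D *+ 3 + j m = D + (j m + D *+ 2) by ring.
  rewrite /z (_ : _ - _ = (j (T X) - j (T (event n a))) +
    (j (T (event n a)) - Po A (j (T s)))); last by rewrite addrA subrK.
  exact: rabs_leD.
have cvgH : seq_cvg (fun n => j (T (partial_sum setT q n))) (j (T s)).
  have := uc_seq_cvg UC (T_order_sums s_sum); congr order_cvg; apply/funext => n.
  by rewrite /partial_sum !raddf_sum.
rewrite -rsub_ge0 -roppr_le0 opprB; set w := z - j m in key *.
(* Read as [H_n <= H - w/3] for all [n]; in the limit [H <= H - w/3], so [w <= 0]. *)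
have w3 n : 3%:R^-1 *: w <= j (T s) - j (T (partial_sum setT q n)).
  rewrite -(@rscale_leP _ _ 3%:R)// scalerA mulfV ?pnatr_eq0// scale1r scaler_nat.
  exact: key.
have i3 : (0 : R) < 3%:R^-1 by rewrite invr_gt0.
rewrite -(rscale_leP _ _ i3) scaler0 -roppr_ge0 -(rleD2l (j (T s))) addr0.
apply: (seq_cvg_le cvgH (N := 0)) => n _.
by rewrite rle_subr addrC -rle_subr.
Qed.

End PoissonApproximation.

Theorem theorem4p11 (R : realType) (E : rieszSpaceType R) (Eu : fAlgebraType R)
    (j : {linear E -> Eu}) (u : E) (T : {linear E -> E})
    (E_complete : dedekind_complete E)
    (u_unit : weak_order_unit u)
    (Eu_completion : universal_completion j)
    (Eu_one : j u = fone)
    (T_ce : conditional_expectation T)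
    (T_strict : strictly_positive T)
    (Tu : T u = u)
    (E_L1 : T_universally_complete j T)
    (q : nat -> E)
    (q_comp : forall i, is_component u (q i))
    (q_indep : indep_component_family j T u q)
    (s : E) (s_sum : order_sums setT q s)
    (A : set nat) :
  rabs (j (cond_prob T u s A) - Po A (j (T s)))
    <= j (supremum 0 (range (fun i => T (q i)))).
Proof. exact: (poisson_bound E_complete Eu_completion Eu_one T_ce Tu q_comp q_indep s_sum). Qed.
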